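(* For $\lambda \in \mathbb{R}\setminus\{0,-1\}$ let $E_\lambda$ be the elliptic curve defined by $$E_\lambda : y^2 = (x-1)(x^2+\lambda).$$ Then for every real $\lambda > 0$, $${}_3F_2\left(\begin{array}{ccc} \frac12, & \frac12, & \frac12 \\ & 1, & 1\end{array}\Big|\; \frac{\lambda}{1+\lambda}\right) = \frac{\sqrt{1+\lambda}\;\,\Omega(E_\lambda)^2}{\pi^2},$$ where $\Omega(E_\lambda)$ is the real period of $E_\lambda$.
   Context: Ordinary hypergeometric series: for complex $a_1,\dots,a_p$, $b_1,\dots,b_q$, $z$ (no $b_i$ being zero or a negative integer), $${}_pF_q\left(\begin{array}{cccc} a_1, & a_2, & \dots, & a_p \\ & b_1, & \dots, & b_q\end{array}\Big|\; z\right) := \sum_{n=0}^{\infty} \frac{(a_1)_n (a_2)_n\cdots (a_p)_n}{(b_1)_n\cdots (b_q)_n}\,\frac{z^n}{n!},$$ where $(a)_0 := 1$ and $(a)_n := a(a+1)\cdots(a+n-1)$ for positive integers $n$. Real period: for an elliptic curve $E$ written in the form $y^2 = 4x^3 - g_2x - g_3$ with $g_2,g_3\in\mathbb{R}$, let $\Lambda\subset\mathbb{C}$ be the period lattice such that $z\mapsto(\wp(z),\wp'(z),1)$ for $z\notin\Lambda$, $z\mapsto(0,1,0)$ for $z\in\Lambda$, gives a biholomorphic map $\mathbb{C}/\Lambda\to E(\mathbb{C})$, where $\wp$ is the Weierstrass $\wp$-function of $\Lambda$. Then $\Lambda$ can be written $\Lambda=\Omega(E)\mathbb{Z}+\Omega'(E)\mathbb{Z}$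 with $\Omega(E)\in\mathbb{R}$ and $\Omega'(E)\in\mathbb{C}$; $\Omega(E)$, taken positive, is called the real period of $E$ (it is the positive generator of $\Lambda\cap\mathbb{R}$). For a curve $y^2=f(x)$ with $f$ a monic real cubic, such as $E_\lambda$, the real period is that of the curve $y^2=4f(x)$ obtained by replacing $y$ by $y/2$, with $x$ translated to remove the quadratic term of $f$. *)

(* Defs.v *)
From mathcomp Require Import all_boot all_order all_algebra.
From mathcomp Require Import complex separable.
From mathcomp Require Import all_classical all_reals all_analysis.
From mathcomp Require Import showcase.summability.
From mathcomp Require Import ring.

Set Implicit Arguments.
Unset Strict Implicit.
Unset Printing Implicit Defensive.

Import Order.TTheory GRing.Theory Num.Theory.
Import numFieldNormedType.Exports.

Local Open Scope classical_set_scope.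
Local Open Scope ring_scope.

(* R[i], typed as an abstract field: this is what gives it its canonical
   topology and its structure of normed module over itself, so that
   [differentiable] and [derive1] below are complex differentiability. *)
Definition Cx (R : realType) : numClosedFieldType := complex R.

Definition toCx {R : realType} (x : R) : Cx R := (x%:C)%C.

Section Hypergeometric.
Variable R : realType.
Local Notation C := (Cx R).

Definition pochhammer (a : C) (n : nat) : C := \prod_(i < n) (a + i%:R).

Definition pFq_term (a b : seq C) (z : C) (n : nat) : C :=
  (\prod_(x <- a) pochhammer x n) / (\prod_(y <- b) pochhammer y n)
  * (z ^+ n / n`!%:R).

(* To be used only when no element of b is zero or a negative integer and the
   series converges; [limn] has an unspecified value when it does not. *)
Definition pFq (a b : seq C) (z : C) : C := limn (series (pFq_term a b z)).

End Hypergeometric.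

Section PeriodLattice.
Variable R : realType.
Local Notation C := (Cx R).

Definition Zspan (w1 w2 : C) : set C :=
  [set z | exists m n : int, z = m%:~R * w1 + n%:~R * w2].

Definition is_lattice (L : set C) : Prop :=
  exists w1 w2 : C,
    (forall s t : R, toCx s * w1 + toCx t * w2 = 0 -> s = 0 /\ t = 0) /\
    L = Zspan w1 w2.

(* The sum is unordered: it is the limit along the finite subsets of C, of which
   only the points of L other than 0 contribute. *)
Definition weierstrass_p (L : set C) (z : C) : C :=
  z ^- 2 +
  sum (fun w : C => if (w \in L) && (w != 0) then (z - w) ^- 2 - w ^- 2 else 0).

Definition vec3 (x y z : C) : 'rV[C]_3 :=
  \row_(j < 3) [:: x; y; z]`_j.

(* Points of the projective plane are nonzero vectors, taken up to [proj_eq]. *)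
Definition proj_eq (u v : 'rV[C]_3) : Prop := exists2 c : C, c != 0 & u = c *: v.

(* Homogeneous coordinates of the points of y^2 = 4x^3 - g2 x - g3, including
   its point at infinity (0 : 1 : 0). *)
Definition curve_points (g2 g3 : R) : set 'rV[C]_3 :=
  [set v | v != 0 /\
    v 0 1 ^+ 2 * v 0 2%:R =
      4%:R * v 0 0 ^+ 3 - toCx g2 * v 0 0 * v 0 2%:R ^+ 2
      - toCx g3 * v 0 2%:R ^+ 3].

Definition weierstrass_map (L : set C) (z : C) : 'rV[C]_3 :=
  if z \in L then vec3 0 1 0
  else vec3 (weierstrass_p L z) (derive1 (weierstrass_p L) z) 1.

(* [phi] induces a biholomorphic map from C/L onto the set of projective points
   with homogeneous coordinates in E. The third clause is injectivity together
   with compatibility with the quotient by L. In the fourth, a map to the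
   projective plane is holomorphic when it locally has a holomorphic lift to
   nonzero vectors. In the last, a map from the projective curve to C/L is
   holomorphic when, after composition with the projection from the cone E, it
   locally lifts to C and extends to a holomorphic function of three variables. *)
Definition biholomorphic_onto (L : set C) (phi : C -> 'rV[C]_3)
    (E : set 'rV[C]_3) : Prop :=
  [/\ forall z, E (phi z),
      forall v, E v -> exists z, proj_eq (phi z) v,
      forall z z', proj_eq (phi z) (phi z') <-> L (z - z'),
      forall z0 : C, exists F : C -> 'rV[C]_3,
        \forall z \near z0, differentiable F z /\ proj_eq (F z) (phi z) &
      forall v0 : 'rV[C]_3, E v0 -> exists G : 'rV[C]_3 -> C,
        \forall v \near v0,
          differentiable G v /\ (E v -> proj_eq (phi (G v)) v)].

Definition is_period_lattice (g2 g3 : R) (L : set C) : Prop :=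
  is_lattice L /\
  biholomorphic_onto L (weierstrass_map L) (curve_points g2 g3).

Definition is_weierstrass_real_period (g2 g3 Omega : R) : Prop :=
  exists L : set C,
    [/\ is_period_lattice g2 g3 L,
        0 < Omega &
        exists Omega' : C, L = Zspan (toCx Omega) Omega'].

End PeriodLattice.

(* The curve y^2 = f(x), where f is [cubic]. *)
Record elliptic_curve (R : realType) := EllipticCurve {
  cubic : {poly R};
  cubic_monic : cubic \is monic;
  cubic_size : size cubic = 4;
  cubic_separable : separable_poly cubic }.

(* Replacing y by y/2 turns y^2 = f(x) into y^2 = 4 f(x); h is the translation
   of x that removes the quadratic term. *)
Definition is_real_period (R : realType) (E : elliptic_curve R) (Omega : R) :
    Prop :=
  exists h g2 g3 : R,
    4%:R *: (cubic E \Po ('X + h%:P)) = 4%:R *: 'X^3 - g2 *: 'X - g3%:P /\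
    is_weierstrass_real_period g2 g3 Omega.

Section Elambda.
Variables (R : realType) (lambda : R).

Definition cubic_lambda : {poly R} := ('X - 1%:P) * ('X^2 + lambda%:P).

Lemma cubic_lambda_monic : cubic_lambda \is monic.
Proof. by rewrite monicMl ?monicXsubC ?monicXnaddC. Qed.

Lemma cubic_lambda_size : size cubic_lambda = 4.
Proof.
rewrite size_monicM ?monicXsubC ?monic_neq0 ?monicXnaddC //.
by rewrite size_XsubC size_XnaddC.
Qed.

Hypotheses (lambda0 : lambda != 0) (lambda1 : lambda != -1).

Lemma cubic_lambda_separable : separable_poly cubic_lambda.
Proof.
rewrite separable_mul; apply/and3P; split; first by rewrite unlock derivXsubC coprimep1.
  rewrite unlock derivD derivXn derivC addr0 /=.
  apply/Bezout_eq1_coprimepP.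
  exists (lambda^-1%:P, - (lambda^-1 / 2%:R)%:P * 'X) => /=.
  have e : lambda^-1%:P * lambda%:P = 1 :> {poly R} by rewrite -polyCM mulVf.
  have d : (lambda^-1 / 2%:R)%:P *+ 2 = lambda^-1%:P :> {poly R}.
    by rewrite -polyCMn -[_ *+ 2]mulr_natr divfK ?pnatr_eq0.
  by move: e; rewrite -d => <-; ring.
rewrite coprimep_sym coprimep_XsubC /root !hornerE expr1n.
by rewrite addrC addr_eq0.
Qed.

Definition E_lambda : elliptic_curve R :=
  EllipticCurve cubic_lambda_monic cubic_lambda_size cubic_lambda_separable.

End Elambda.

(* Main.v *)
(* Put [x = 1 - h + r^2 cot^2 t] with [r^4 = 1 + lambda] on the Weierstrass model:
   the real points of the curve form one closed loop, [0 <= t <= pi], running from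
   the point at infinity back to itself, on which
   [dx / y = dt / (r sqrt (1 - q sin^2 (2 t)))], [q = (1 - r^-2) / 2].
   A local inverse of the Weierstrass map along the loop differs by a constant from
   the real primitive [J] of this form, since its derivative is [(dx/dt) / y]; hence
   [J t], with [J 0 = 0], is mapped to the point [t] of the loop.  So [J pi] is the
   least positive real period, and expanding the integrand with the binomial series
   gives [r Omega = pi F(q)], [F = 2F1(1/2, 1/2; 1)].  Comparing differential
   equations, [F(q) = 2F1(1/4, 1/4; 1; 4 q (1 - q))], where
   [4 q (1 - q) = lambda / (1 + lambda)], and Clausen's formula squares the
   right-hand side into the [3F2] series. *)
Require Import Defs.
From mathcomp Require Import all_boot all_order all_algebra.
From mathcomp Require Import all_classical all_reals all_analysis.
From mathcomp Require Import complex ring lra.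
Import Order.TTheory GRing.Theory Num.Theory.
Import numFieldNormedType.Exports.
Local Open Scope classical_set_scope.
Local Open Scope ring_scope.

(** * Self-convolution of sequences and squares of series *)

Section Convolution.
Set Implicit Arguments.
Unset Strict Implicit.
Variable R : realType.
Implicit Types a w : R ^nat.

Definition autoconv a n : R := \sum_(i < n.+1) a i * a (n - i)%N.

Lemma sum_ord_swap (F : nat -> nat -> R) n :
  \sum_(i < n.+1) F i (n - i)%N = \sum_(i < n.+1) F (n - i)%N i.
Proof.
rewrite (reindex_inj rev_ord_inj) /=; apply: eq_bigr => i _.
by rewrite subSS subKn // -ltnS.
Qed.

(** The indices [i] and [n - i] contribute the same product, so the weights may be averaged over the
    pair. With [w i = i] this is the Leibniz rule [theta (A ^ 2) = 2 A theta A] read on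
    coefficients. *)
Lemma autoconv_weight a w n (d : R) :
  (forall i, (i <= n)%N -> w i + w (n - i)%N = d) ->
  d * autoconv a n = 2 * \sum_(i < n.+1) w i * a i * a (n - i)%N.
Proof.
move=> wd; rewrite [2 * _]mulrDl !mul1r.
rewrite [X in _ = _ + X](sum_ord_swap (fun i j => w i * a i * a j)).
rewrite -big_split mulr_sumr; apply: eq_bigr => i _.
by rewrite -(wd i) ?(leq_ord i)//=; ring.
Qed.

(** Expand [(w i + w j) ^ 3] with [j = n - i]; by symmetry one half of the terms may be counted
    twice. This isolates the factor [w i ^ 2 * a i], on which a recurrence with squared weights can
    act. *)
Lemma autoconv_weight3 a w n (d : R) :
  (forall i, (i <= n)%N -> w i + w (n - i)%N = d) ->
  d ^+ 3 * autoconv a n =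
  \sum_(i < n.+1) (2 * w i + 6 * w (n - i)%N) * (w i ^+ 2 * a i) * a (n - i)%N.
Proof.
move=> wd.
pose F i j := (w i ^+ 3 + 3 * w i ^+ 2 * w j) * a i * a j.
transitivity (\sum_(i < n.+1) F i (n - i)%N + \sum_(i < n.+1) F (n - i)%N i).
  rewrite -big_split mulr_sumr; apply: eq_bigr => i _.
  by rewrite -(wd i) ?(leq_ord i)// /F /=; ring.
rewrite -(sum_ord_swap F) -big_split; apply: eq_bigr => i _.
by rewrite /F /=; ring.
Qed.

(** The square [i, j < N] contains the triangle [i + j < N] and lies in the triangle [i + j < 2 N].
    The truncated polynomial [p] turns this into a comparison with the coefficients of [p * p]. *)
Lemma series_autoconv_le a N : (forall n, 0 <= a n) ->
  series (autoconv a) N <= series a N ^+ 2 <= series (autoconv a) N.*2.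
Proof.
move=> a0.
pose p := \poly_(i < N) a i.
have pE : p.[1] = series a N.
  rewrite horner_poly /series /= big_mkord; apply: eq_bigr => i _.
  by rewrite expr1n mulr1.
have p2 : p.[1] ^+ 2 = \sum_(i < N.*2) (p * p)`_i.
  rewrite expr2 -hornerM (@horner_coef_wide _ N.*2); last first.
    rewrite (leq_trans (size_polyMleq _ _)) // (leq_trans (leq_pred _)) //.
    by rewrite -addnn leq_add // size_poly.
  by apply: eq_bigr => i _; rewrite expr1n mulr1.
have ple i : 0 <= p`_i <= a i by rewrite coef_poly; case: ifP; rewrite ?lexx ?a0.
have ppge0 i : 0 <= (p * p)`_i.
  rewrite coefM sumr_ge0 // => j _.
  by case/andP: (ple j) => ? _; case/andP: (ple (i - j)%N) => ? _; exact: mulr_ge0.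
rewrite -pE p2 /series /= !big_mkord; apply/andP; split.
  rewrite -addnn big_split_ord /= -[X in X <= _]addr0.
  rewrite lerD ?sumr_ge0 //; apply: ler_sum => i _.
  rewrite /autoconv coefM le_eqVlt; apply/orP; left; apply/eqP.
  apply: eq_bigr => j _; rewrite !coef_poly.
  rewrite (leq_ltn_trans (leq_ord j) (ltn_ord i)).
  by rewrite (leq_ltn_trans (leq_subr _ _) (ltn_ord i)).
apply: ler_sum => i _; rewrite coefM; apply: ler_sum => j _.
by case/andP: (ple j) => ? ?; case/andP: (ple (i - j)%N) => ? ?; exact: ler_pM.
Qed.

Lemma cvgn_ler (u : R ^nat) (l b : R) :
  u @ \oo --> l -> (forall n, u n <= b) -> l <= b.
Proof.
move=> ul ub; rewrite -(cvg_lim _ ul) //.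
by apply: limr_le; [exact: cvgP ul | exact: nearW].
Qed.

Lemma cvgn_ger (u : R ^nat) (l b : R) :
  u @ \oo --> l -> (forall n, b <= u n) -> b <= l.
Proof.
move=> ul ub; rewrite -(cvg_lim _ ul) //.
by apply: limr_ge; [exact: cvgP ul | exact: nearW].
Qed.

Lemma ge0_series_homo a : (forall n, 0 <= a n) -> nondecreasing_seq (series a).
Proof. by move=> a0; apply/nondecreasing_seqP => n; rewrite seriesSr lerDl. Qed.

Lemma ge0_series_le a (l : R) n : (forall n, 0 <= a n) ->
  series a @ \oo --> l -> series a n <= l.
Proof.
move=> a0 al; rewrite -(cvg_lim _ al) //.
by apply: nondecreasing_cvgn_le; [exact: ge0_series_homo | exact: cvgP al].
Qed.

Lemma ge0_series_ge0 a n : (forall n, 0 <= a n) -> 0 <= series a n.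
Proof. by move=> a0; rewrite /series /= sumr_ge0. Qed.

(** Monotone and bounded partial sums give convergence; the two sides of [series_autoconv_le] then
    determine the limit. *)
Lemma cvg_series_autoconv a (l : R) : (forall n, 0 <= a n) ->
  series a @ \oo --> l -> series (autoconv a) @ \oo --> l ^+ 2.
Proof.
move=> a0 al.
have al2 : (fun n => series a n ^+ 2) @ \oo --> l ^+ 2 by apply: cvgM.
have c0 n : 0 <= autoconv a n by rewrite sumr_ge0 // => i _; rewrite mulr_ge0.
have h n : series a n ^+ 2 <= l ^+ 2.
  have h1 := ge0_series_le n a0 al.
  by rewrite ler_pXn2r // nnegrE ?(le_trans _ h1) // ge0_series_ge0.
have cv : cvgn (series (autoconv a)).
  apply: nondecreasing_is_cvgn; first exact: ge0_series_homo.
  exists (l ^+ 2) => _ [n _ <-].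
  by case/andP: (series_autoconv_le n a0) => h1 _; exact: le_trans h1 (h n).
suff -> : l ^+ 2 = limn (series (autoconv a)) by [].
apply/eqP; rewrite eq_le; apply/andP; split.
  apply: cvgn_ler al2 _ => n.
  case/andP: (series_autoconv_le n a0) => _ /le_trans; apply.
  exact: ge0_series_le.
apply: cvgn_ler cv _ => n.
by case/andP: (series_autoconv_le n a0) => h1 _; exact: le_trans h1 (h n).
Qed.

End Convolution.

(** * Convolution identities for the binomial and Gauss coefficients *)

Section RisingRatio.
Set Implicit Arguments.
Unset Strict Implicit.
Variable R : realType.

(* [(a)_n / n!] *)
Definition rising_ratio (a : R) n : R := \prod_(i < n) ((a + i%:R) / i.+1%:R).

Lemma rising_ratioS (a : R) n :
  n.+1%:R * rising_ratio a n.+1 = (a + n%:R) * rising_ratio a n.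
Proof.
by rewrite /rising_ratio big_ord_recr /= mulrCA mulrC mulrCA divff ?mulr1 ?pnatr_eq0 // mulrC.
Qed.

Lemma rising_ratio0 (a : R) : rising_ratio a 0 = 1.
Proof. by rewrite /rising_ratio big_ord0. Qed.

Lemma rising_ratio_ge0 (a : R) n : 0 <= a -> 0 <= rising_ratio a n.
Proof. by move=> a0; rewrite prodr_ge0 // => i _; rewrite divr_ge0 // addr_ge0. Qed.

Lemma rising_ratio_le1 (a : R) n : 0 <= a <= 1 -> rising_ratio a n <= 1.
Proof.
move=> /andP[a0 a1]; apply: prodr_ile1 => i _; rewrite divr_ge0 ?addr_ge0 //=.
by rewrite ler_pdivrMr ?ltr0Sn // mul1r -natr1 addrC lerD2l.
Qed.

(** Coefficient form of [((1 - x) ^ (-1/2)) ^ 2 = 1 / (1 - x)]. *)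
Lemma autoconv_rising_half n : autoconv (rising_ratio 2^-1) n = 1.
Proof.
set b := rising_ratio _; elim: n => [|n IHn].
  by rewrite /autoconv big_ord_recl big_ord0 /b rising_ratio0 mulr1 addr0.
have n1 : (n.+1%:R : R) != 0 by rewrite pnatr_eq0.
apply: (mulfI n1); transitivity (n.+1%:R * autoconv b n); last by rewrite IHn.
(* The weights [i + 1/2] at order [n] and [i] at order [n + 1] both have pair sum [n + 1]. By
   [rising_ratioS] the two weighted sums agree term by term, after the zero term [i = 0] of the
   second is dropped. *)
rewrite (@autoconv_weight R b (fun i => i%:R + 2^-1) n n.+1%:R); last first.
  by move=> i /subnKC ni; rewrite -(natr1 n) -[in RHS]ni natrD; field.
rewrite (@autoconv_weight R b (fun i => i%:R) n.+1 n.+1%:R); last first.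
  by move=> i le_in; rewrite -natrD subnKC.
congr (_ * _); rewrite [LHS]big_ord_recl /= !(mulr0n, mul0r) add0r.
by apply: eq_bigr => i _; rewrite /bump leq0n add1n rising_ratioS subSS [_ + 2^-1]addrC.
Qed.

(* The recurrence is the coefficient form of [theta ^ 3 (A ^ 2) = m (theta + 1/2) ^ 3 (A ^ 2)],
   [theta = m d/dm], which follows from [theta ^ 2 A = m (theta + 1/4) ^ 2 A]. *)
Lemma clausen_coef n :
  autoconv (fun k => rising_ratio 4^-1 k ^+ 2) n = rising_ratio 2^-1 n ^+ 3.
Proof.
set b := fun k => _; elim: n => [|n IHn].
  by rewrite /autoconv big_ord_recl big_ord0 /b !rising_ratio0 !expr1n mulr1 addr0.
have n1 : (n.+1%:R : R) ^+ 3 != 0 by rewrite expf_neq0 // pnatr_eq0.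
have bS k : k.+1%:R ^+ 2 * b k.+1 = (k%:R + 4^-1) ^+ 2 * b k.
  by rewrite /b -!exprMn rising_ratioS [4^-1 + _]addrC.
apply: (mulfI n1); rewrite -exprMn rising_ratioS exprMn -IHn.
rewrite (@autoconv_weight3 R b (fun i => i%:R + 4^-1) n (2^-1 + n%:R)); last first.
  by move=> i /subnKC ni; rewrite -[in RHS]ni natrD; field.
rewrite (@autoconv_weight3 R b (fun i => i%:R) n.+1 n.+1%:R); last first.
  by move=> i le_in; rewrite -natrD subnKC.
rewrite [LHS]big_ord_recl /= !(mulr0n, expr0n, mul0r, mulr0) add0r.
apply: eq_bigr => i _; rewrite /bump leq0n add1n subSS bS -(natr1 i).
(* The parameter 1/4 makes the linear factors agree: [2 (i + 1) + 6 (n - i) = 2 (i + 1/4) + 6 (n - i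
   + 1/4)]. *)
by congr (_ * _ * _); field.
Qed.

End RisingRatio.

(** * Power series on the unit disc *)

Section UnitDiscSeries.
Variable R : realType.
Set Implicit Arguments.
Unset Strict Implicit.
Implicit Type c : R ^nat.

(** The general term is the self-convolution of the geometric sequence. *)
Lemma cvg_series_succ_geometric (q : R) : 0 <= q < 1 ->
  cvgn (series (fun n => n.+1%:R * q ^+ n)).
Proof.
move=> /andP[q0 q1].
have -> : (fun n => n.+1%:R * q ^+ n) = autoconv (fun n => q ^+ n).
  apply/funext => n; rewrite /autoconv (eq_bigr (fun=> q ^+ n)) => [|i _].
    by rewrite sumr_const card_ord mulr_natl.
  by rewrite -exprD subnKC // leq_ord.
have := @cvg_geometric_series R 1 q.
rewrite ger0_norm // => /(_ q1) h; apply: cvgP.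
apply: cvg_series_autoconv; first by move=> n; rewrite exprn_ge0.
have -> : (fun n => q ^+ n) = geometric 1 q by apply/funext => n /=; rewrite mul1r.
exact: h.
Qed.

Lemma cvg_pseries_diffs c : (forall x : R, `|x| < 1 -> cvgn (pseries c x)) ->
  forall x, `|x| < 1 -> cvgn (pseries (pseries_diffs c) x).
Proof.
move=> cc x x1.
(* At [r], strictly between [|x|] and 1, the terms [c n * r ^+ n] are bounded, so the differentiated
   series at [x] is dominated by a multiple of [(n + 1) (|x| / r) ^ n]. *)
pose r := (`|x| + 1) / 2.
have r0 : 0 < r by rewrite divr_gt0 // ltr_wpDl.
have xr : `|x| < r by rewrite /r; lra.
have r1 : `|r| < 1 by rewrite gtr0_norm // /r; lra.
have /cvg_series_cvg_0 /cvgP /cvg_seq_bounded [M [Mr hM]] := cc r r1.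
have {hM} hM n : `|c n * r ^+ n| <= M + 1 by apply: (hM (M + 1)) => //; rewrite ltrDl.
have q01 : 0 <= `|x| / r < 1.
  by rewrite divr_ge0 ?(ltW r0) //= ltr_pdivrMr // mul1r.
have cq := cvg_series_succ_geometric q01.
apply: normed_cvg.
apply: (@series_le_cvg _ _ (fun n => (M + 1) / r * (n.+1%:R * (`|x| / r) ^+ n))) =>
  [n|n|n|]; first exact: normr_ge0.
- have q0 : 0 <= `|x| / r by case/andP: q01.
    rewrite !mulr_ge0 ?exprn_ge0 ?invr_ge0 ?(ltW r0) //.
  by rewrite (le_trans _ (hM 0%N)).
- rewrite /= /pseries_diffs !normrM normr_nat normrX.
  have := hM n.+1; rewrite normrM normrX (gtr0_norm r0) -ler_pdivlMr ?exprn_gt0 // => h.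
  rewrite [leRHS](_ : _ = n.+1%:R * ((M + 1) / r ^+ n.+1) * `|x| ^+ n).
    by rewrite ler_wpM2r ?exprn_ge0 // ler_wpM2l.
  rewrite expr_div_n exprS; field.
  by rewrite expf_neq0 ?gt_eqF.
- by have := @is_cvg_seriesZ _ _ ((M + 1) / r) cq.
Qed.

Lemma is_derive_pseries c : (forall x : R, `|x| < 1 -> cvgn (pseries c x)) ->
  forall x : R, `|x| < 1 ->
  is_derive x (1 : R) (fun x => limn (pseries c x)) (limn (pseries (pseries_diffs c) x)).
Proof.
move=> cc x x1; have r0 := normr_ge0 x.
have r1 : `|(`|x| + 1) / 2| < 1 by rewrite ger0_norm; lra.
have cd := cvg_pseries_diffs cc; have cdd := cvg_pseries_diffs cd.
apply: (@pseries_snd_diffs _ _ ((`|x| + 1) / 2)); [exact: cc | exact: cd | exact: cdd |].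
by rewrite [ltRHS]ger0_norm; lra.
Qed.

End UnitDiscSeries.

(** * The Gauss series and its differential equation *)

Section GaussSeries.
Variables (R : realType) (a : R).
Hypothesis a01 : 0 <= a <= 1.
Set Implicit Arguments.
Unset Strict Implicit.

Let c n := rising_ratio a n ^+ 2.

Let a0 : 0 <= a. Proof. by case/andP: a01. Qed.

Lemma cvg_gauss (x : R) : `|x| < 1 -> cvgn (pseries c x).
Proof.
move=> x1; apply: normed_cvg.
apply: (@series_le_cvg _ _ (geometric 1 `|x|)) =>
  [n|n|n|]; first exact: normr_ge0.
- by rewrite /= mul1r exprn_ge0.
- rewrite /= mul1r normrM !normrX ler_piMl ?exprn_ge0 // exprn_ile1 //.
  by rewrite ger0_norm ?rising_ratio_le1 ?rising_ratio_ge0.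
- by apply: is_cvg_geometric_series; rewrite normr_id.
Qed.

(** This is [2F1(a, a; 1; x)]; [gauss1] and [gauss2] are its first two derivatives on the unit
    disc. *)
Definition gauss x := limn (pseries (fun n => rising_ratio a n ^+ 2) x).
Definition gauss1 x := limn (pseries (pseries_diffs (fun n => rising_ratio a n ^+ 2)) x).
Definition gauss2 x :=
  limn (pseries (pseries_diffs (pseries_diffs (fun n => rising_ratio a n ^+ 2))) x).

Lemma is_derive_gauss (x : R) : `|x| < 1 -> is_derive x (1 : R) gauss (gauss1 x).
Proof. by move=> x1; apply: is_derive_pseries x1; exact: cvg_gauss. Qed.

Lemma is_derive_gauss1 (x : R) : `|x| < 1 -> is_derive x (1 : R) gauss1 (gauss2 x).
Proof.
by move=> x1; apply: is_derive_pseries x1; apply: cvg_pseries_diffs; exact: cvg_gauss.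
Qed.

Lemma gauss_ode (x : R) : `|x| < 1 ->
  x * (1 - x) * gauss2 x + (1 - (1 + 2 * a) * x) * gauss1 x = a ^+ 2 * gauss x.
Proof.
move=> x1; set d1 := pseries_diffs c; set d2 := pseries_diffs d1.
have c0 := cvg_gauss x1.
have c1 : cvgn (pseries d1 x) by apply: cvg_pseries_diffs x1; exact: cvg_gauss.
have c2 : cvgn (pseries d2 x).
  by apply: cvg_pseries_diffs x1; apply: cvg_pseries_diffs; exact: cvg_gauss.
have cS n : n.+1%:R ^+ 2 * c n.+1 = (a + n%:R) ^+ 2 * c n.
  by rewrite /c -!exprMn rising_ratioS.
(* The lengths are staggered so that all three partial sums stop at the coefficient [c N.+1]: [w N]
   is the differential operator applied to a truncation. The recurrence [cS] cancels everything but
   the top power, which tends to 0. *)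
pose w N := x * (1 - x) * pseries d2 x N + (1 - (1 + 2 * a) * x) * pseries d1 x N.+1
     - a ^+ 2 * pseries c x N.+2.
have wE N : w N = - x * (d2 N * x ^+ N) - d1 N.+1 * x ^+ N.+1.
  have SS f n : pseries f x n.+1 = pseries f x n + f n * x ^+ n.
    by rewrite /pseries seriesSr.
  elim: N => [|N IHN]; apply/eqP; rewrite -subr_eq0; apply/eqP.
    rewrite /w !SS /d2 /d1 /pseries_diffs ![pseries _ _ 0%N]/series /= !big_nil.
    transitivity (1 ^+ 2 * c 1%N - (a + 0) ^+ 2 * c 0%N
      + x * (2 ^+ 2 * c 2%N - (a + 1) ^+ 2 * c 1%N)); first by ring.
    by rewrite (cS 0%N) (cS 1%N) !subrr mulr0 addr0.
  have wS : w N.+1 = w N + x * (1 - x) * (d2 N * x ^+ N)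
     + (1 - (1 + 2 * a) * x) * (d1 N.+1 * x ^+ N.+1) - a ^+ 2 * (c N.+2 * x ^+ N.+2).
    by rewrite /w (SS d2) (SS d1 N.+1) (SS c N.+2); ring.
  transitivity (x ^+ 2 * x ^+ N * (N.+3%:R ^+ 2 * c N.+3 - (a + N.+2%:R) ^+ 2 * c N.+2)).
    by rewrite wS IHN /d2 /d1 /pseries_diffs !exprS; ring.
  by rewrite cS subrr mulr0.
have w0 : w @ \oo --> 0.
  rewrite (funext wE) -[0](_ : - x * 0 - 0 = 0); last by rewrite mulr0 subr0.
  apply: cvgB; first by apply: cvgMr; exact: cvg_series_cvg_0 c2.
  by rewrite (cvg_shiftS (fun n => d1 n * x ^+ n)); exact: cvg_series_cvg_0 c1.
have wl : w @ \oo --> x * (1 - x) * gauss2 x + (1 - (1 + 2 * a) * x) * gauss1 x - a ^+ 2 * gauss x.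
  apply: cvgB; first apply: cvgD.
  - by apply: cvgMr.
  - apply: cvgMr; rewrite (cvg_shiftS (pseries d1 x)). exact: c1.
  - apply: cvgMr; rewrite (cvg_shiftS (fun n => pseries c x n.+1)) cvg_shiftS. exact: c0.
apply/eqP; rewrite -subr_eq0; apply/eqP.
by rewrite -(cvg_lim _ wl) // (cvg_lim _ w0).
Qed.

End GaussSeries.

(** * Differentiation rules and the mean value theorem on the real line *)

Section RealDerivatives.
Variable R : realType.
Set Implicit Arguments.
Unset Strict Implicit.
Implicit Types (f g : R -> R) (x a b : R).

Lemma is_derive_add f g x a b :
  is_derive x (1 : R) f a -> is_derive x (1 : R) g b ->
  is_derive x (1 : R) (fun y => f y + g y) (a + b).
Proof. by move=> fa gb; exact: is_deriveD. Qed.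

Lemma is_derive_opp f x a :
  is_derive x (1 : R) f a -> is_derive x (1 : R) (fun y => - f y) (- a).
Proof. by move=> fa; exact: is_deriveN. Qed.

Lemma is_derive_mul f g x a b :
  is_derive x (1 : R) f a -> is_derive x (1 : R) g b ->
  is_derive x (1 : R) (fun y => f y * g y) (a * g x + f x * b).
Proof.
move=> fa gb; apply: (is_derive_eq (f := f * g)).
by rewrite /GRing.scale /= addrC [g x * a]mulrC.
Qed.

Lemma is_derive_inv f x a : f x != 0 ->
  is_derive x (1 : R) f a -> is_derive x (1 : R) (fun y => (f y)^-1) (- a / f x ^+ 2).
Proof.
move=> fx0 fa; have := is_deriveV fx0 fa => h; apply: is_derive_eq h _.
by rewrite /GRing.scale /= mulNr mulNr mulrC.
Qed.

Lemma is_derive_exp f x a n : is_derive x (1 : R) f a ->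
  is_derive x (1 : R) (fun y => f y ^+ n) (n%:R * f x ^+ n.-1 * a).
Proof.
move=> fa; have h := @is_deriveX _ _ f n x 1 a fa.
by rewrite (_ : (fun y => f y ^+ n) = (f ^+ n)) //; apply/funext => y; rewrite exprfctE.
Qed.

Lemma is_derive_const c x : is_derive x (1 : R) (fun=> c : R) 0.
Proof. exact: is_derive_cst. Qed.

Lemma is_derive_idfun x : is_derive x (1 : R) (fun y => y) 1.
Proof. exact: is_derive_id. Qed.

Lemma is_derive_comp_fun f g x a b :
  is_derive (g x) (1 : R) f a -> is_derive x (1 : R) g b ->
  is_derive x (1 : R) (fun y => f (g y)) (a * b).
Proof. by move=> fa gb; exact: is_derive1_comp. Qed.

Lemma is_derive_continuous f x a : is_derive x (1 : R) f a -> {for x, continuous f}.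
Proof. by move=> [h _]; apply: differentiable_continuous; apply/derivable1_diffP. Qed.

Lemma mean_value f df a b : a < b ->
  (forall x, a <= x <= b -> {for x, continuous f}) ->
  (forall x, a < x < b -> is_derive x (1 : R) f (df x)) ->
  exists2 c, a < c < b & f b - f a = df c * (b - a).
Proof.
move=> ab cf fd.
have fd' x : x \in `]a, b[%R -> is_derive x (1 : R) f (df x).
  by move=> xab; apply: fd; rewrite !(itvP xab).
have [|c] := MVT ab fd'.
  apply: continuous_in_subspaceT => x /set_mem /= xab.
  by apply: cf; rewrite !(itvP xab).
by move=> cab fE; exists c => //; rewrite !(itvP cab).
Qed.

Lemma eq_of_derive0 f a b : a <= b ->
  (forall x, a <= x <= b -> {for x, continuous f}) ->
  (forall x, a < x < b -> is_derive x (1 : R) f 0) -> f a = f b.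
Proof.
rewrite le_eqVlt => /predU1P[-> //|ab] cf df.
have [c _] := mean_value ab cf df.
by rewrite mul0r => /eqP; rewrite subr_eq0 => /eqP ->.
Qed.

End RealDerivatives.

Ltac derive_rules :=
  repeat first [ eassumption | apply: is_derive_const | apply: is_derive_idfun
    | apply: is_derive_add | apply: is_derive_opp | apply: is_derive_mul
    | apply: is_derive_exp ].

Ltac derive_as :=
  notypeclasses refine (is_derive_eq _ _);
  [by derive_rules | rewrite /GRing.scale /=].

(** * The quadratic transformation of the Gauss series *)

Section GaussQuadratic.
Variable R : realType.

Lemma half01 : 0 <= (2^-1 : R) <= 1. Proof. by lra. Qed.
Lemma quarter01 : 0 <= (4^-1 : R) <= 1. Proof. by lra. Qed.

(** All terms are nonnegative and the first is 1. The bound allows division by the series. *)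
Lemma gauss_ge1 (a x : R) : 0 <= a <= 1 -> 0 <= x < 1 -> 1 <= gauss a x.
Proof.
move=> a01 /andP[x0 x1].
have cg : cvgn (pseries (fun n => rising_ratio a n ^+ 2) x).
  by apply: cvg_gauss => //; rewrite ger0_norm.
have := @ge0_series_le _ (fun n => rising_ratio a n ^+ 2 * x ^+ n) (gauss a x) 1.
rewrite /series /= big_nat1 rising_ratio0 expr0 expr1n mulr1; apply; last exact: cg.
by move=> n; rewrite mulr_ge0 ?exprn_ge0 // rising_ratio_ge0 //; case/andP: a01.
Qed.

Lemma gauss0 (a : R) : gauss a 0 = 1.
Proof.
rewrite /gauss (_ : pseries _ 0 = fun n => (0 < n)%:R).
  apply: cvg_lim => //; rewrite -cvg_shiftS /=; exact: cvg_cst.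
apply/funext => -[|n]; rewrite /pseries /series /= ?big_nil //.
rewrite big_nat_recl //= rising_ratio0 expr0 expr1n mulr1 big1 ?addr0 // => i _.
by rewrite expr0n mulr0.
Qed.

(* Both sides satisfy [(x (1 - x) u')' = u / 4], so that their Wronskian times
   [x (1 - x)] is constant; it vanishes at 0. *)
Lemma gauss_quadratic (x : R) : 0 <= x < 2^-1 ->
  gauss 2^-1 x = gauss 4^-1 (4 * x * (1 - x)).
Proof.
move=> /andP[x0 xh].
pose m (y : R) := 4 * y * (1 - y).
(* [1 - m y = (1 - 2 y) ^ 2] is positive because [y <= x < 1/2]. *)
have m1 y : 0 <= y <= x -> `|m y| < 1.
  by move=> /andP[y0 yx]; rewrite /m ger0_norm; nra.
have y1 y : 0 <= y <= x -> `|y| < 1.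
  by move=> /andP[y0 yx]; rewrite ger0_norm; lra.
have dm y : is_derive y (1 : R) m (4 * (1 - 2 * y)).
  rewrite /m; derive_as; ring.
pose H y := gauss 4^-1 (m y).
pose H1 y := gauss1 4^-1 (m y) * (4 * (1 - 2 * y)).
have dH y : 0 <= y <= x -> is_derive y (1 : R) H (H1 y).
  move=> yx; apply: is_derive_comp_fun (dm y).
  exact: is_derive_gauss quarter01 _ (m1 y yx).
have dH1 y : 0 <= y <= x -> is_derive y (1 : R) H1
    (gauss2 4^-1 (m y) * (4 * (1 - 2 * y)) * (4 * (1 - 2 * y)) - 8 * gauss1 4^-1 (m y)).
  move=> yx; have h := is_derive_gauss1 quarter01 (m1 y yx).
  have h' := is_derive_comp_fun h (dm y).
  rewrite /H1; derive_as; ring.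
pose F := gauss (2^-1 : R); pose F1 := gauss1 (2^-1 : R).
have dF y : 0 <= y <= x -> is_derive y (1 : R) F (F1 y).
  by move=> yx; exact: is_derive_gauss half01 _ (y1 y yx).
have dF1 y : 0 <= y <= x -> is_derive y (1 : R) F1 (gauss2 2^-1 y).
  by move=> yx; exact: is_derive_gauss1 half01 _ (y1 y yx).
pose w y := y * (1 - y) * (H1 y * F y - H y * F1 y).
have dw z : 0 <= z <= x -> is_derive z (1 : R) w 0.
  move=> zx.
  have hF := dF z zx; have hF1 := dF1 z zx; have hH := dH z zx; have hH1 := dH1 z zx.
  rewrite /w; derive_as.
  have e1 := gauss_ode half01 (y1 z zx).
  have e2 := gauss_ode quarter01 (m1 z zx).
  (* The derivative is [4 F] times the equation of [gauss 4^-1] at [m z], minus [H] times the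
     equation of [F] at [z]. *)
  transitivity (4 * F z * (m z * (1 - m z) * gauss2 4^-1 (m z)
      + (1 - (1 + 2 * 4^-1) * m z) * gauss1 4^-1 (m z) - 4^-1 ^+ 2 * H z)
    - H z * (z * (1 - z) * gauss2 2^-1 z + (1 - (1 + 2 * 2^-1) * z) * F1 z
      - 2^-1 ^+ 2 * F z)); first by rewrite /F /F1 /H1 /H /m; field.
  by rewrite e1 e2 !subrr !mulr0 subrr.
have w0 y : 0 <= y <= x -> w y = 0.
  move=> /andP[y0 yx]; rewrite -[RHS](_ : w 0 = 0); last by rewrite /w !mul0r.
  have zx z : 0 <= z <= y -> 0 <= z <= x.
    by move=> /andP[-> zy]; exact: le_trans zy yx.
  apply/esym/eq_of_derive0 => [|z zy|z zy]; first exact: y0.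
    by apply: is_derive_continuous (dw z _); exact: zx.
  by case/andP: zy => z0 zy; apply/dw/zx; rewrite !ltW.
have F_neq0 y : 0 <= y <= x -> F y != 0.
  move=> /andP[y0 yx]; apply: lt0r_neq0; apply: lt_le_trans ltr01 _.
  by apply: gauss_ge1 half01 _; rewrite y0 (le_lt_trans yx) //; lra.
(* The derivative of [H / F] is the Wronskian over [F ^ 2]. The mean value theorem evaluates it at
   an interior point [c], where the factor [c (1 - c)] of [w] is nonzero and can be cancelled. *)
pose q y := H y * (F y)^-1.
have qE : q 0 = q x.
  have dq y : 0 <= y <= x ->
      is_derive y (1 : R) q (H1 y * (F y)^-1 + H y * (- F1 y / F y ^+ 2)).
    move=> yx; apply: is_derive_mul; first exact: dH.
    by apply: is_derive_inv; [exact: F_neq0 | exact: dF].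
  have [->//|x_neq0] := eqVneq x 0.
  have x_gt0 : 0 < x by rewrite lt_def x_neq0.
  have dq' z : 0 < z < x ->
      is_derive z (1 : R) q (H1 z * (F z)^-1 + H z * (- F1 z / F z ^+ 2)).
    by move=> /andP[z0 zx]; apply: dq; rewrite !ltW.
  have [|c /andP[c0 cx]] := mean_value x_gt0 _ dq'.
    by move=> z zx; exact: is_derive_continuous (dq z zx).
  have cx' : 0 <= c <= x by rewrite !ltW.
  have /eqP := w0 c cx'; rewrite mulf_eq0 gt_eqF /=; last by rewrite mulr_gt0 //; lra.
  rewrite subr_eq0 => /eqP e.
  have -> : H1 c * (F c)^-1 + H c * (- F1 c / F c ^+ 2) = 0.
    transitivity ((H1 c * F c - H c * F1 c) / F c ^+ 2); last by rewrite e subrr mul0r.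
    by have Fc := F_neq0 c cx'; field.
  by rewrite mul0r => /eqP; rewrite subr_eq0 => /eqP ->.
move: qE; rewrite /q /H /F /m gauss0 mulr0 mul0r gauss0 divr1 => e.
have Fx : F x != 0 by apply: F_neq0; rewrite x0 lexx.
by apply: (mulIf (invr_neq0 Fx)); rewrite divff // -e.
Qed.

End GaussQuadratic.

(** * Clausen's formula and the binomial series of [(1 - x) ^ (-1/2)] *)

Section PositiveSeries.
Variable R : realType.
Set Implicit Arguments.
Unset Strict Implicit.

Lemma autoconv_pow (c : R ^nat) (x : R) n :
  autoconv (fun k => c k * x ^+ k) n = autoconv c n * x ^+ n.
Proof.
rewrite /autoconv mulr_suml; apply: eq_bigr => i _.
by rewrite -[in X in _ = _ * X](subnKC (leq_ord i)) exprD; ring.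
Qed.

Lemma clausen (x : R) : 0 <= x < 1 ->
  pseries (fun n => rising_ratio 2^-1 n ^+ 3) x @ \oo --> gauss 4^-1 x ^+ 2.
Proof.
move=> /andP[x0 x1].
have := @cvg_series_autoconv _ (fun n => rising_ratio 4^-1 n ^+ 2 * x ^+ n) (gauss 4^-1 x).
rewrite (funext (autoconv_pow _ x)) (funext (@clausen_coef R)); apply.
  by move=> n; rewrite mulr_ge0 ?exprn_ge0 // rising_ratio_ge0.
by apply: (@cvg_gauss R 4^-1 (quarter01 R)); rewrite ger0_norm.
Qed.

(** By [autoconv_rising_half] the square of the sum is the geometric series; nonnegativity of the
    sum selects the positive root. *)
Lemma binomial_half (x : R) : 0 <= x < 1 ->
  pseries (rising_ratio 2^-1) x @ \oo --> (Num.sqrt (1 - x))^-1.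
Proof.
move=> /andP[x0 x1].
have t0 n : 0 <= rising_ratio 2^-1 n * x ^+ n.
  by rewrite mulr_ge0 ?exprn_ge0 // rising_ratio_ge0.
have nx : `|x| < 1 by rewrite ger0_norm.
have cv : cvgn (pseries (rising_ratio 2^-1) x).
  apply: (@series_le_cvg _ _ (geometric 1 x)) => // [n|n|].
  - by rewrite /= mul1r exprn_ge0.
  - by rewrite /= mul1r ler_piMl ?exprn_ge0 // rising_ratio_le1 // half01.
  - exact: is_cvg_geometric_series.
have h := cvg_series_autoconv t0 cv.
rewrite (funext (autoconv_pow _ x)) (funext (@autoconv_rising_half R)) in h.
have h1 := @cvg_geometric_series _ 1 _ nx.
have e := cvg_unique _ h h1.
suff -> : (Num.sqrt (1 - x))^-1 = limn (pseries (rising_ratio 2^-1) x) by [].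
have l0 : 0 <= limn (pseries (rising_ratio 2^-1) x).
  by apply: cvgn_ger cv _ => n; exact: ge0_series_ge0.
by rewrite -sqrtrV ?subr_ge0 ?(ltW x1) // -[_^-1]mul1r -e // sqrtr_sqr ger0_norm.
Qed.

End PositiveSeries.

(** * The complete elliptic integral as a Gauss series *)

Section CompleteElliptic.
Variable R : realType.
Set Implicit Arguments.
Unset Strict Implicit.

(** Integration starts at [a], where nothing is claimed; the choice [a = -1] below makes 0 an
    interior point. *)
Lemma exists_primitive (f : R -> R) (a : R) : continuous f ->
  exists J : R -> R, forall x, a < x -> is_derive x (1 : R) J (f x).
Proof.
move=> cf; pose J x : R := (\int[lebesgue_measure]_(t in `[a, x]) f t)%R.
exists J => x ax.
have x1 : x < x + 1 by rewrite ltrDl.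
have [||h1 h2] := @continuous_FTC1_closed R f a x _ x1 _ ax.
- apply: continuous_compact_integrable; first exact: segment_compact.
  exact: continuous_subspaceT.
- exact: cf.
have h3 : 'D_1 J x = f x by rewrite -h2 derive1E.
exact: (DeriveDef h1 h3).
Qed.

Lemma natr_double n : n.*2%:R = 2 * n%:R :> R.
Proof. by rewrite -mul2n natrM. Qed.

(** A primitive of [sin (2 x) ^ (2 n)], given by the reduction formula from integration by parts. *)
Fixpoint wallis n (x : R) : R :=
  if n is n'.+1 then
    ((n'.*2).+1%:R * wallis n' x - sin (2 * x) ^+ (n'.*2).+1 * cos (2 * x) / 2)
      / (n'.+1).*2%:R
  else x.

Lemma is_derive_sin2 (x : R) : is_derive x (1 : R) (fun y => sin (2 * y)) (2 * cos (2 * x)).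
Proof.
have h := is_derive_sin (2 * x).
have := @is_derive_comp_fun R sin (fun y => 2 * y) x _ (0 * x + 2 * 1) h => h2.
rewrite (_ : 2 * cos (2 * x) = cos (2 * x) * (0 * x + 2 * 1)); last by ring.
by apply: h2; derive_rules.
Qed.

Lemma is_derive_cos2 (x : R) : is_derive x (1 : R) (fun y => cos (2 * y)) (- (2 * sin (2 * x))).
Proof.
have h := is_derive_cos (2 * x).
have := @is_derive_comp_fun R cos (fun y => 2 * y) x _ (0 * x + 2 * 1) h => h2.
rewrite (_ : - (2 * sin (2 * x)) = - sin (2 * x) * (0 * x + 2 * 1)); last by ring.
by apply: h2; derive_rules.
Qed.

Lemma is_derive_wallis n (x : R) :
  is_derive x (1 : R) (wallis n) ((sin (2 * x) ^+ 2) ^+ n).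
Proof.
elim: n => [|n IHn]; first by rewrite expr0; exact: is_derive_idfun.
have hs := is_derive_sin2 x; have hc := is_derive_cos2 x.
change (is_derive x (1 : R) (fun y =>
  ((n.*2).+1%:R * wallis n y - sin (2 * y) ^+ (n.*2).+1 * cos (2 * y) / 2)
    / (n.+1).*2%:R) ((sin (2 * x) ^+ 2) ^+ n.+1)).
derive_as.
have c2 : cos (2 * x) * cos (2 * x) = 1 - sin (2 * x) ^+ 2.
  by apply/eqP; rewrite eq_sym subr_eq -expr2 cos2Dsin2.
rewrite natr_double -!exprM !mul2n doubleS !exprS !mulr0 !addr0.
have n0 : (n.+1%:R : R) != 0 by rewrite pnatr_eq0.
transitivity (((n.*2).+1%:R * sin (2 * x) ^+ n.*2 * (1 - cos (2 * x) * cos (2 * x))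
   + sin (2 * x) ^+ 2 * sin (2 * x) ^+ n.*2) / (2 * n.+1%:R)).
  by field.
by rewrite c2 -(natr1 n.*2) natr_double -(natr1 n); field; rewrite natr1.
Qed.

(** The boundary terms vanish since [sin (2 x)] is 0 at both ends; what remains is the recurrence of
    [rising_ratio 2^-1]. *)
Lemma wallis_pi n : wallis n pi - wallis n 0 = pi * rising_ratio 2^-1 n.
Proof.
have s0 : sin (2 * 0) = 0 :> R by rewrite mulr0 sin0.
have sp : sin (2 * pi) = 0 :> R by rewrite mulr_natl sin_mulr2n sinpi mulr0 mul0rn.
elim: n => [|n IHn] /=; first by rewrite rising_ratio0 subr0 mulr1.
rewrite s0 sp !(expr0n, exprS, mul0r) !subr0 -mulrBl -mulrBr IHn.
have n0 : n.+1%:R != 0 :> R by rewrite pnatr_eq0.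
have := rising_ratioS (2^-1 : R) n => h.
apply: (mulfI n0); rewrite [RHS]mulrCA h.
rewrite !natr_double -(natr1 n.*2) natr_double -(natr1 n).
by field; rewrite natr1.
Qed.

Lemma gauss_primitive (q : R) (J : R -> R) : 0 <= q < 1 ->
  (forall x, 0 <= x <= pi ->
     is_derive x (1 : R) J (Num.sqrt (1 - q * sin (2 * x) ^+ 2))^-1) ->
  J pi - J 0 = pi * gauss 2^-1 q.
Proof.
move=> /andP[q0 q1] dJ.
pose b n := rising_ratio (2^-1 : R) n.
have b0 n : 0 <= b n by rewrite rising_ratio_ge0.
pose B t := (Num.sqrt (1 - t))^-1 : R.
have cB t : 0 <= t <= q -> pseries b t @ \oo --> B t.
  by move=> /andP[t0 tq]; apply: binomial_half; rewrite t0 (le_lt_trans tq).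
(* The coefficients are nonnegative, so the remainder of the binomial series increases with [t], and
   its value at [q] is a bound uniform in the angle. *)
have tail N t : 0 <= t <= q -> 0 <= B t - pseries b t N <= B q - pseries b q N.
  move=> tq; have /andP[t0 tq'] := tq.
  have qq : 0 <= q <= q by rewrite q0 lexx.
  have s0 s : 0 <= s -> forall n, 0 <= b n * s ^+ n.
    by move=> s0 n; rewrite mulr_ge0 ?exprn_ge0.
  rewrite subr_ge0 (ge0_series_le _ (s0 t t0) (cB t tq)) /=.
  have cd : (fun n => pseries b q n - pseries b t n) @ \oo --> B q - B t.
    by apply: cvgB; exact: cB.
  have cE : (fun n => pseries b q n - pseries b t n)
      = series (fun n => b n * (q ^+ n - t ^+ n)).
    apply/funext => n; rewrite /pseries /series /= -sumrB.
    by apply: eq_bigr => i _; rewrite mulrBr.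
  have h : pseries b q N - pseries b t N <= B q - B t.
    have -> : pseries b q N - pseries b t N
        = series (fun n => b n * (q ^+ n - t ^+ n)) N by rewrite -cE.
    apply: ge0_series_le; last by rewrite -cE.
    by move=> n; rewrite mulr_ge0 // subr_ge0 lerXn2r.
  by lra.
pose W N x := \sum_(0 <= n < N) b n * q ^+ n * wallis n x.
have dW N x : is_derive x (1 : R) (W N) (pseries b (q * sin (2 * x) ^+ 2) N).
  elim: N => [|N IHN].
    rewrite /W /pseries /series /= big_nil.
    rewrite (_ : (fun x => _) = fun=> 0); first exact: is_derive_const.
    by apply/funext => y; rewrite big_nil.
  rewrite /pseries seriesSr.
  rewrite (_ : W N.+1 = fun y => W N y + b N * q ^+ N * wallis N y); last first.
    by apply/funext => y; rewrite /W big_nat_recr.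
  have dw := is_derive_wallis N x.
  apply: (is_derive_add IHN).
  rewrite /= exprMn mulrA.
  by derive_as; ring.
(* The mean value theorem for [J - W N] on [[0, pi]] takes the place of termwise integration; both
   bounds tend to [pi * gauss 2^-1 q]. *)
have bound N : pi * series (fun n => b n ^+ 2 * q ^+ n) N <= J pi - J 0 <=
    pi * series (fun n => b n ^+ 2 * q ^+ n) N + pi * (B q - pseries b q N).
  have dE x : 0 <= x <= pi -> is_derive x (1 : R) (fun y => J y - W N y)
      (B (q * sin (2 * x) ^+ 2) - pseries b (q * sin (2 * x) ^+ 2) N).
    by move=> xpi; have h1 := dJ x xpi; have h2 := dW N x; exact: is_deriveB.
  have dE' x : 0 < x < pi -> is_derive x (1 : R) (fun y => J y - W N y)
      (B (q * sin (2 * x) ^+ 2) - pseries b (q * sin (2 * x) ^+ 2) N).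
    by move=> /andP[x0 xpi]; apply: dE; rewrite !ltW.
  have [|c _] := mean_value (pi_gt0 R) _ dE'.
    by move=> x xpi; exact: is_derive_continuous (dE x xpi).
  have -> : J pi - W N pi - (J 0 - W N 0)
      = J pi - J 0 - pi * series (fun n => b n ^+ 2 * q ^+ n) N.
    suff <- : W N pi - W N 0 = pi * series (fun n => b n ^+ 2 * q ^+ n) N by ring.
    rewrite /W /series /= -sumrB mulr_sumr; apply: eq_bigr => i _.
    by rewrite -mulrBr wallis_pi /b; ring.
  have s1 : sin (2 * c) ^+ 2 <= 1.
    by have := cos2Dsin2 (2 * c); have := sqr_ge0 (cos (2 * c)); lra.
  have sq : 0 <= q * sin (2 * c) ^+ 2 <= q.
    by rewrite mulr_ge0 ?sqr_ge0 //= ler_piMr.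
  have /andP[t0 t1] := tail N _ sq.
  have pi0 := pi_ge0 R.
  move: (B _ - _) t0 t1 => d d0 d1 e.
  have : 0 <= d * (pi - 0) by rewrite subr0 mulr_ge0.
  have : d * (pi - 0) <= pi * (B q - pseries b q N) by rewrite subr0 mulrC ler_wpM2l.
  by rewrite -e; lra.
have cg : (fun N => pi * series (fun n => b n ^+ 2 * q ^+ n) N) @ \oo --> pi * gauss 2^-1 q.
  by apply: cvgMr; apply: cvg_gauss (half01 R) _ _; rewrite ger0_norm.
have cu : (fun N => pi * series (fun n => b n ^+ 2 * q ^+ n) N + pi * (B q - pseries b q N))
    @ \oo --> pi * gauss 2^-1 q.
  rewrite -[pi * gauss _ _](_ : pi * gauss 2^-1 q + pi * (B q - B q) = _); last first.
    by rewrite subrr mulr0 addr0.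
  apply: cvgD cg _; apply: cvgMr; apply: cvgB; first exact: cvg_cst.
  by apply: cB; rewrite q0 lexx.
apply/eqP; rewrite eq_le; apply/andP; split.
  by apply: cvgn_ger cu _ => n; case/andP: (bound n).
by apply: cvgn_ler cg _ => n; case/andP: (bound n).
Qed.

End CompleteElliptic.

(** * The complex plane *)

Section ComplexPlane.
Variable R : realType.
Set Implicit Arguments.
Unset Strict Implicit.
Local Notation C := (Cx R).

Lemma toCxB (x y : R) : toCx (x - y) = toCx x - toCx y.
Proof. exact: (rmorphB (real_complex R)). Qed.
Lemma toCxD (x y : R) : toCx (x + y) = toCx x + toCx y.
Proof. exact: (rmorphD (real_complex R)). Qed.
Lemma toCxN (x : R) : toCx (- x) = - toCx x.
Proof. exact: (rmorphN (real_complex R)). Qed.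
Lemma toCxM (x y : R) : toCx (x * y) = toCx x * toCx y.
Proof. exact: (rmorphM (real_complex R)). Qed.
Lemma toCxV (x : R) : toCx x^-1 = (toCx x)^-1.
Proof. exact: (fmorphV (real_complex R)). Qed.
Lemma toCxX (x : R) n : toCx (x ^+ n) = toCx x ^+ n.
Proof. exact: (rmorphXn (real_complex R)). Qed.
Lemma toCx_nat n : toCx (n%:R : R) = n%:R.
Proof. exact: (rmorph_nat (real_complex R)). Qed.
Lemma toCx_int n : toCx (n%:~R : R) = n%:~R.
Proof. exact: (rmorph_int (real_complex R)). Qed.
Lemma toCx0 : toCx (0 : R) = 0. Proof. by []. Qed.
Lemma toCx1 : toCx (1 : R) = 1. Proof. by []. Qed.
Lemma toCxI : injective (toCx : R -> C). Proof. exact: complexI. Qed.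
Lemma toCx_eq0 (x : R) : (toCx x == 0) = (x == 0).
Proof. exact: (fmorph_eq0 (real_complex R)). Qed.

Lemma norm_toCx (x : R) : `|toCx x| = toCx `|x|.
Proof. by rewrite /toCx normc_def /= expr0n addr0 sqrtr_sqr. Qed.

Lemma ltr_toCx (x y : R) : (toCx x < toCx y) = (x < y).
Proof. exact: ltcR. Qed.

Lemma ler_toCx (x y : R) : (toCx x <= toCx y) = (x <= y).
Proof. exact: lecR. Qed.

Lemma norm_Re (z : C) : toCx `|complex.Re z| <= `|z|.
Proof. exact: normc_ge_Re. Qed.

Lemma norm_Im (z : C) : toCx `|complex.Im z| <= `|z|.
Proof.
rewrite normc_def ler_toCx -sqrtr_sqr ler_wsqrtr //.
by rewrite lerDr sqr_ge0.
Qed.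

Lemma toCx_continuous : continuous (toCx : R -> C).
Proof.
move=> x; apply/cvgrPdist_lt => e e0.
(* A positive element of [C] is real, so the radius comes from [R]. *)
have er : e = toCx (complex.Re e).
  by rewrite /toCx RRe_real // gtr0_real.
have e0' : 0 < complex.Re e by rewrite -ltr_toCx -er.
near=> y; rewrite -toCxB norm_toCx er ltr_toCx.
near: y; exact: cvgr_dist_lt.
Unshelve. all: by end_near. Qed.

Lemma Re_continuous : continuous (@complex.Re R : C -> R).
Proof.
move=> z; apply/(@cvgrPdist_lt _ _ _ (nbhs (z : C)) (nbhs_filter (z : C))) => e e0.
near=> w; rewrite -ltr_toCx -(raddfB (@complex.Re R)).
apply: le_lt_trans (norm_Re _) _.
by near: w; apply: (@cvgr_dist_lt _ _ _ (nbhs z) _ id z) => //; rewrite -toCx0 ltr_toCx.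
Unshelve. all: by end_near. Qed.

Lemma Im_continuous : continuous (@complex.Im R : C -> R).
Proof.
move=> z; apply/(@cvgrPdist_lt _ _ _ (nbhs (z : C)) (nbhs_filter (z : C))) => e e0.
near=> w; rewrite -ltr_toCx -(raddfB (@complex.Im R)).
apply: le_lt_trans (norm_Im _) _.
by near: w; apply: (@cvgr_dist_lt _ _ _ (nbhs z) _ id z) => //; rewrite -toCx0 ltr_toCx.
Unshelve. all: by end_near. Qed.

Lemma cvg_vec3 (T : Type) (F : set_system T) (FF : Filter F) (f g h : T -> C) (a b c : C) :
  f @ F --> a -> g @ F --> b -> h @ F --> c ->
  (fun t => vec3 (f t) (g t) (h t)) @ F --> vec3 a b c.
Proof.
move=> fa gb hc.
apply/cvg_ballP => e e0.
have ha : \forall t \near F, ball a e (f t) by exact: cvg_ball fa _ e0.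
have hb : \forall t \near F, ball b e (g t) by exact: cvg_ball gb _ e0.
have hh : \forall t \near F, ball c e (h t) by exact: cvg_ball hc _ e0.
near=> t; split=> // i j.
have ta : ball a e (f t) by near: t.
have tb : ball b e (g t) by near: t.
have tc : ball c e (h t) by near: t.
by rewrite !mxE; case: j => -[|[|[|//]]] ltj.
Unshelve. all: by end_near. Qed.

Lemma proj_eq_sym (u v : 'rV[C]_3) : proj_eq u v -> proj_eq v u.
Proof.
move=> [c c0 ->]; exists c^-1; first by rewrite invr_eq0.
by rewrite scalerA mulVf // scale1r.
Qed.

Lemma proj_eq_trans (u v w : 'rV[C]_3) : proj_eq u v -> proj_eq v w -> proj_eq u w.
Proof.
move=> [c c0 ->] [d d0 ->]; exists (c * d); first by rewrite mulf_neq0.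
by rewrite scalerA.
Qed.

Lemma proj_eq_vec3 (a b c x y z : C) : proj_eq (vec3 a b c) (vec3 x y z) ->
  exists2 k : C, k != 0 & [/\ a = k * x, b = k * y & c = k * z].
Proof.
move=> [k k0 /rowP e]; exists k => //.
by split; [have := e 0 | have := e 1 | have := e 2%:R]; rewrite !mxE.
Qed.

End ComplexPlane.

(** * Derivative of a path lifted through a complex function *)

Section LiftedPath.
Variable R : realType.
Set Implicit Arguments.
Unset Strict Implicit.
Local Notation C := (Cx R).

Lemma cvg_sub_self (z : C) : (fun w : C => w - z) @ z --> (0 : C).
Proof.
rewrite -(subrr z).
have h1 : (fun w : C => w) @ z --> z by [].
have h2 : (fun w : C => z) @ z --> z.
  exact: (@cvg_cst C z _ (nbhs z) (nbhs_filter z)).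
exact: (cvgB h1 h2).
Qed.

(** The difference quotient is completed by its limit at [z1], so that it can be composed with a
    path that may return to [z1]. *)
Lemma derive1_quotient_cvg (f : C -> C) (z1 : C) : derivable f z1 1 ->
  (fun z => if z == z1 then derive1 f z1 else (z - z1)^-1 * (f z - f z1)) @ z1
    --> derive1 f z1.
Proof.
move=> fd; set D := derive1 f z1.
have hD : (fun h : C => h^-1 *: (f (h *: 1 + z1) - f z1)) @ 0^' --> D.
  by rewrite /D derive1E; exact: fd.
apply/(@cvgrPdist_lt _ _ _ (nbhs (z1 : C)) (nbhs_filter (z1 : C))) => e e0.
have hn : \forall h \near (0 : C)^', `|D - h^-1 *: (f (h *: 1 + z1) - f z1)| < e.
  exact: (@cvgr_dist_lt _ _ _ _ _ _ _ hD _ e0).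
have zc : (fun z : C => z - z1) @ z1 --> (0 : C).
  exact: cvg_sub_self.
have hz : \forall z \near z1, z - z1 != 0 ->
    `|D - (z - z1)^-1 *: (f ((z - z1) *: 1 + z1) - f z1)| < e.
  exact: (zc _ hn).
near=> z; case: eqVneq => [_|zz1]; first by rewrite subrr normr0.
have : z - z1 != 0 -> `|D - (z - z1)^-1 *: (f ((z - z1) *: 1 + z1) - f z1)| < e by near: z.
by rewrite subr_eq0 /GRing.scale /= mulr1 subrK; exact.
Unshelve. all: by end_near. Qed.

(** With [Q] the completed difference quotient of [f], the increment of [x] is that of [g] times
    [Q]. As [Q] tends to [y], which is nonzero, dividing gives the limit; [g] is only assumed
    continuous. *)
Lemma lifted_path_cvg (f : C -> C) (g : R -> C) (x : R -> R) (t a y : R) :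
  derivable f (g t) 1 -> derive1 f (g t) = toCx y -> y != 0 ->
  {for t, continuous g} -> is_derive t (1 : R) x a ->
  (\forall s \near t, f (g s) = toCx (x s)) ->
  (fun h : R => toCx h^-1 * (g (h *: 1 + t) - g t)) @ 0^' --> toCx (a / y).
Proof.
move=> fd fy y0 gc [xd xa] fg.
pose Q z := if z == g t then derive1 f (g t) else (z - g t)^-1 * (f z - f (g t)).
have QE z : (z - g t) * Q z = f z - f (g t).
  rewrite /Q; case: eqVneq => [->|zt]; first by rewrite !subrr mul0r.
  by rewrite mulrA divff ?mul1r // subr_eq0.
have shift : (fun h : R => h *: 1 + t) @ 0^' --> t.
  rewrite -[X in _ --> X](_ : 0 *: 1 + t = t); last by rewrite scale0r add0r.
  apply: cvgD; last exact: cvg_cst.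
  by apply: cvgZr_tmp; apply: cvg_within.
have Qc : (fun h : R => Q (g (h *: 1 + t))) @ 0^' --> toCx y.
  rewrite -fy; apply: (cvg_comp (fun h : R => g (h *: 1 + t)) Q).
    apply: (cvg_comp (fun h : R => h *: 1 + t) g); first exact: shift.
    exact: gc.
  exact: derive1_quotient_cvg.
have yC : toCx y != 0 by rewrite toCx_eq0.
have xc : (fun h : R => toCx (h^-1 *: (x (h *: 1 + t) - x t))) @ 0^' --> toCx a.
  apply: (cvg_comp _ (toCx : R -> C)); last exact: toCx_continuous.
  by rewrite -xa; exact: xd.
rewrite toCxM toCxV.
apply: cvg_trans (cvgM xc (cvgV yC Qc)); apply: near_eq_cvg.
near=> h => /=.
have Q0 : Q (g (h *: 1 + t)) != 0.
  near: h; exact: cvgr_neq0 Qc yC.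
have e1 : f (g (h *: 1 + t)) = toCx (x (h *: 1 + t)).
  by near: h; exact: shift fg.
have e0 : f (g t) = toCx (x t) by exact: (nbhs_singleton fg).
apply: (mulIf Q0); rewrite mulfVK // -mulrA QE e1 e0 -toCxB -toCxM.
by rewrite /GRing.scale.
Unshelve. all: by end_near. Qed.

(** The limit is real. Real and imaginary parts are separated so that the real mean value theorem
    applies to each. *)
Lemma lifted_path_derive (f : C -> C) (g : R -> C) (x : R -> R) (t a y : R) :
  derivable f (g t) 1 -> derive1 f (g t) = toCx y -> y != 0 ->
  {for t, continuous g} -> is_derive t (1 : R) x a ->
  (\forall s \near t, f (g s) = toCx (x s)) ->
  is_derive t (1 : R) (fun s => complex.Re (g s)) (a / y) /\
  is_derive t (1 : R) (fun s => complex.Im (g s)) 0.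
Proof.
move=> fd fy y0 gc xd fg.
have h := lifted_path_cvg fd fy y0 gc xd fg.
have hr : (fun h : R => h^-1 *: (complex.Re (g (h *: 1 + t)) - complex.Re (g t)))
    @ 0^' --> a / y.
  have := cvg_comp _ (@complex.Re R : C -> R) h (@Re_continuous R (toCx (a / y))).
  apply: cvg_trans; apply: near_eq_cvg; apply: nearW => k /=.
  rewrite -(raddfB (@complex.Re R)).
  by case: (_ - _) => u v; rewrite /toCx /=; simpc.
have hi : (fun h : R => h^-1 *: (complex.Im (g (h *: 1 + t)) - complex.Im (g t)))
    @ 0^' --> (0 : R).
  have := cvg_comp _ (@complex.Im R : C -> R) h (@Im_continuous R (toCx (a / y))).
  apply: cvg_trans; apply: near_eq_cvg; apply: nearW => k /=.
  rewrite -(raddfB (@complex.Im R)).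
  by case: (_ - _) => u v; rewrite /toCx /=; simpc.
by split; apply: DeriveDef; [apply: cvgP hr | apply: cvg_lim hr
  | apply: cvgP hi | apply: cvg_lim hi].
Qed.

End LiftedPath.

(** * The Weierstrass function off the lattice *)

Section WeierstrassDerivable.
Variable R : realType.
Set Implicit Arguments.
Unset Strict Implicit.
Local Notation C := (Cx R).
Variables (L : set C) (E : set 'rV[C]_3).
Hypothesis bihol : biholomorphic_onto L (weierstrass_map L) E.

Lemma weierstrass_map_notin (z : C) : z \notin L ->
  weierstrass_map L z = vec3 (weierstrass_p L z) (derive1 (weierstrass_p L) z) 1.
Proof. by rewrite /weierstrass_map => /negbTE ->. Qed.

Lemma weierstrass_map_in (z : C) : z \in L -> weierstrass_map L z = vec3 0 1 0.
Proof. by rewrite /weierstrass_map => ->. Qed.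

(** A nonzero third coordinate excludes [(0 : 1 : 0)], hence [z] in [L]; scaling that coordinate to
    1 reads off the others. *)
Lemma weierstrass_map_affine (z a b c : C) : c != 0 ->
  proj_eq (weierstrass_map L z) (vec3 a b c) ->
  [/\ z \notin L, weierstrass_p L z = a / c & derive1 (weierstrass_p L) z = b / c].
Proof.
move=> c0; have [zL|zL] := boolP (z \in L).
  rewrite weierstrass_map_in // => /proj_eq_vec3[k k0 [_ _ /esym/eqP]].
  by rewrite mulf_eq0 (negbTE k0) (negbTE c0).
rewrite weierstrass_map_notin // => /proj_eq_vec3[k k0 [-> -> e]].
have -> : k = c^-1 by rewrite -[c^-1]mul1r e mulfK.
by split=> //; rewrite mulrC.
Qed.

(** Derived from the biholomorphy rather than from the series: near [z] the function is the quotient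
    of the first and third coordinates of a holomorphic lift [F]. *)
Lemma weierstrass_p_derivable (z : C) : z \notin L -> derivable (weierstrass_p L) z 1.
Proof.
move=> zL; case: bihol => _ _ _ /(_ z)[F Fz] _.
have [Fdz pz] := nbhs_singleton Fz.
have dc j : derivable (fun w => F w 0 j) z 1.
  apply: diff_derivable.
  have h := @differentiable_coord _ 1 3 (F z) 0 j.
  exact: (@differentiable_comp _ _ _ _ F _ z Fdz h).
have F2 : F z 0 2%:R != 0.
  case: pz => c c0 ->; rewrite weierstrass_map_notin // !mxE /= mulr1.
  exact: c0.
have F2c : (fun w => F w 0 2%:R) @ z --> F z 0 2%:R.
  apply: (cvg_comp F (fun M : 'rV[C]_3 => M 0 2%:R)).
    exact: differentiable_continuous Fdz.
  exact: coord_continuous.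
have F2n : \forall w \near z, F w 0 2%:R != 0.
  exact: (@cvgr_neq0 _ _ _ _ (nbhs_filter z) _ _ F2c F2).
have FE : \forall w \near z, F w 0 0 * (F w 0 2%:R)^-1 = weierstrass_p L w.
  near=> w.
  have w2 : F w 0 2%:R != 0 by near: w.
  have [_ [c c0 e]] : differentiable F w /\ proj_eq (F w) (weierstrass_map L w) by near: w.
  have wL : w \notin L.
    apply/negP => wL; move: w2; rewrite e weierstrass_map_in // !mxE /= mulr0.
    by rewrite eqxx.
  rewrite e weierstrass_map_notin // !mxE /= mulr1.
  by rewrite mulrAC divff ?mul1r.
apply: near_eq_derivable FE _.
by apply: derivableM; [exact: dc | apply: derivableV; [exact: F2 | exact: dc]].
Unshelve. all: by end_near. Qed.

End WeierstrassDerivable.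

(** * The real loop of the curve *)

Section RealLoop.
Variable R : realType.
Set Implicit Arguments.
Unset Strict Implicit.
Local Notation C := (Cx R).
Variables (L : set C) (g2 g3 h lam r : R).
Hypothesis bihol :
  biholomorphic_onto L (weierstrass_map L) (curve_points g2 g3).
Hypothesis cubicE : forall x : R,
  4 * ((x + h - 1) * ((x + h) ^+ 2 + lam)) = 4 * x ^+ 3 - g2 * x - g3.
Hypothesis r1 : 1 < r.
Hypothesis r4 : r ^+ 4 = 1 + lam.

Definition elliptic_parameter : R := (1 - r ^- 2) / 2.

Lemma elliptic_parameter_bounds : 0 <= elliptic_parameter < 2^-1.
Proof.
have r2 : 1 < r ^+ 2 by rewrite exprn_egt1.
have i1 : r ^- 2 <= 1 by rewrite invf_le1 ?(lt_trans ltr01) // ltW.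
have i0 : 0 < r ^- 2 by rewrite invr_gt0 (lt_trans ltr01).
by rewrite /elliptic_parameter; lra.
Qed.

(** Jacobi's delta amplitude at the angle [2 t], with parameter [k ^ 2 = elliptic_parameter]. *)
Definition delta (t : R) : R := Num.sqrt (1 - elliptic_parameter * sin (2 * t) ^+ 2).

Lemma sin_sqr_le1 (t : R) : sin t ^+ 2 <= 1.
Proof. by have := cos2Dsin2 t; have := sqr_ge0 (cos t); lra. Qed.

Lemma delta_arg_gt0 (t : R) : 0 < 1 - elliptic_parameter * sin (2 * t) ^+ 2.
Proof.
have /andP[m0 m1] := elliptic_parameter_bounds.
have := sin_sqr_le1 (2 * t); have := sqr_ge0 (sin (2 * t)).
by move: (sin _ ^+ 2) => s s0 s1; nra.
Qed.

Lemma delta_gt0 (t : R) : 0 < delta t.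
Proof. by rewrite sqrtr_gt0 delta_arg_gt0. Qed.

Lemma sin_double (t : R) : sin (2 * t) = 2 * (sin t * cos t).
Proof. by rewrite mulr_natl sin_mulr2n mulr_natl [cos t * _]mulrC. Qed.

Lemma r_gt0 : 0 < r. Proof. exact: lt_trans r1. Qed.

(** Divided by [sin t ^ 4], with [T = r cot t], the right side is [T ^ 4 + 2 T ^ 2 + r ^ 4], which
    is the factor [(x + h) ^ 2 + lam] of the cubic at [x = 1 - h + T ^ 2]. *)
Lemma delta_sqr (t : R) : r ^+ 4 * delta t ^+ 2 =
  (r * cos t) ^+ 4 + 2 * (r * cos t) ^+ 2 * sin t ^+ 2 + r ^+ 4 * sin t ^+ 4.
Proof.
rewrite sqr_sqrtr ?ltW ?delta_arg_gt0 // sin_double /elliptic_parameter.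
have r0 := lt0r_neq0 r_gt0.
transitivity (r ^+ 4 * (cos t ^+ 2 + sin t ^+ 2) ^+ 2
  - 2 * (r ^+ 4 - r ^+ 2) * (sin t * cos t) ^+ 2); last by ring.
by rewrite cos2Dsin2; field.
Qed.

(* The real locus, parametrized so that dx / y = dt / (r delta t): with
   [T = r cot t] one has [x = 1 - h + T ^ 2]; the point at infinity is [t = 0]. *)
Definition loop_x (t : R) := sin t * (sin t ^+ 2 * (1 - h) + (r * cos t) ^+ 2).
Definition loop_y (t : R) := - (2 * (r * cos t) * (r ^+ 2 * delta t)).
Definition loop_z (t : R) := sin t ^+ 3.
Definition loop (t : R) : 'rV[C]_3 :=
  vec3 (toCx (loop_x t)) (toCx (loop_y t)) (toCx (loop_z t)).

Lemma loop_cubic (t : R) : loop_y t ^+ 2 * loop_z t =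
  4 * loop_x t ^+ 3 - g2 * loop_x t * loop_z t ^+ 2 - g3 * loop_z t ^+ 3.
Proof.
have [s0|s0] := eqVneq (sin t) 0; first by rewrite /loop_x /loop_z s0; ring.
have z0 : loop_z t != 0 by rewrite expf_neq0.
transitivity (loop_z t ^+ 3 * (4 * (loop_x t / loop_z t) ^+ 3
  - g2 * (loop_x t / loop_z t) - g3)); last by field.
rewrite -cubicE.
transitivity (4 * (r * cos t) ^+ 2 * sin t ^+ 3 * (r ^+ 4 * delta t ^+ 2)).
  by rewrite /loop_y /loop_z; ring.
by rewrite delta_sqr r4 /loop_x /loop_z; field.
Qed.

Lemma loop_neq0 (t : R) : loop_z t = 0 -> loop_y t != 0.
Proof.
move=> /eqP; rewrite expf_eq0 /= => /eqP s0.
have c0 : cos t != 0.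
  by apply/eqP => c0; have /eqP := cos2Dsin2 t; rewrite s0 c0 !expr0n /= addr0 eq_sym oner_eq0.
have d0 := lt0r_neq0 (delta_gt0 t); have r0 := lt0r_neq0 r_gt0.
by rewrite oppr_eq0 !mulf_neq0 ?expf_neq0 // pnatr_eq0.
Qed.

Lemma loop_curve (t : R) : curve_points g2 g3 (loop t).
Proof.
split.
  apply/eqP => l0; have v0 (j : 'I_3) : loop t 0 j = 0 by exact: (congr1 (fun f => f 0 j) l0).
  have := v0 2%:R; rewrite !mxE /= => /eqP; rewrite toCx_eq0 => /eqP z0.
  have := v0 1; rewrite !mxE /= => /eqP; rewrite toCx_eq0.
  by apply/negP; exact: loop_neq0.
rewrite !mxE /= -!toCxX -[4%:R]toCx_nat -!toCxM -!toCxB.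
by rewrite loop_cubic.
Qed.

Lemma loop_continuous : continuous loop.
Proof.
move=> t.
have c1 := @continuous_sin R t; have c2 := @continuous_cos R t.
have c3 : {for t, continuous (fun s : R => sin (2 * s))}.
  exact: is_derive_continuous (is_derive_sin2 t).
have rc : (fun s : R => r * cos s) @ t --> r * cos t by apply: cvgMr.
have sX n : (fun s : R => sin s ^+ n) @ t --> sin t ^+ n.
  by apply: (cvg_comp (@sin R) (fun x => x ^+ n)) c1 _; exact: exprn_continuous.
apply: cvg_vec3.
- apply: (cvg_comp loop_x (toCx : R -> C)); last exact: toCx_continuous.
  apply: cvgM => //; apply: cvgD; last first.
    by apply: (cvg_comp _ (fun x : R => x ^+ 2)) rc _; exact: exprn_continuous.
  by apply: cvgM (sX 2) _; exact: cvg_cst.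
- apply: (cvg_comp loop_y (toCx : R -> C)); last exact: toCx_continuous.
  apply: cvgN; apply: cvgM; first by apply: cvgMr.
  apply: cvgMr; apply: (cvg_comp _ (@Num.sqrt R)); last exact: sqrt_continuous.
  apply: cvgB; first exact: cvg_cst.
  by apply: cvgMr; apply: (cvg_comp _ (fun x : R => x ^+ 2)) c3 _; exact: exprn_continuous.
- apply: (cvg_comp loop_z (toCx : R -> C)); last exact: toCx_continuous.
  exact: sX.
Qed.

(** The last clause of [biholomorphic_onto] gives a local inverse [G] of the Weierstrass map at
    [loop t0]; the lift is [G \o loop]. *)
Lemma local_lift (t0 : R) : exists g : R -> C, exists2 d : R, 0 < d &
  forall t, `|t0 - t| < d ->
    {for t, continuous g} /\ proj_eq (weierstrass_map L (g t)) (loop t).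
Proof.
case: bihol => _ _ _ _ /(_ _ (loop_curve t0))[G hG].
have := loop_continuous hG => /nbhs_ballP[d /= d0 hd].
exists (G \o loop), d => // t /hd[Gd Gp]; split; last exact/Gp/loop_curve.
apply: (cvg_comp loop G); first exact: loop_continuous.
exact: differentiable_continuous Gd.
Qed.

Lemma loop_coord_derive (t : R) : sin t != 0 -> cos t != 0 ->
  is_derive t (1 : R) (fun s => loop_x s / loop_z s)
    (loop_y t / loop_z t / (r * delta t)).
Proof.
move=> s0 c0; have ds := is_derive_sin t; have dc := is_derive_cos t.
have z0 : loop_z t != 0 by rewrite expf_neq0.
have dz : is_derive t (1 : R) loop_z (3 * sin t ^+ 2 * cos t).
  by rewrite /loop_z; derive_as; ring.
have dx : is_derive t (1 : R) loop_x
    (3 * sin t ^+ 2 * cos t * (1 - h) + r ^+ 2 * cos t ^+ 3 - 2 * r ^+ 2 * sin t ^+ 2 * cos t).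
  by rewrite /loop_x; derive_as; ring.
have dzV := is_derive_inv z0 dz.
have d0 := lt0r_neq0 (delta_gt0 t); have r0 := lt0r_neq0 r_gt0.
apply: is_derive_eq (is_derive_mul dx dzV) _.
rewrite /loop_x /loop_y.
(* By [cos ^ 2 + sin ^ 2 = 1] this is [- 2 r ^ 2 cos t / sin t ^ 3], the derivative of
   [r ^ 2 cot ^ 2 t]. *)
transitivity (- (2 * r ^+ 2 * cos t * (cos t ^+ 2 + sin t ^+ 2)) / sin t ^+ 3).
  by rewrite /loop_z; field.
by rewrite cos2Dsin2 /loop_z; field; rewrite d0 r0 s0.
Qed.

(** The zeros of [sin (2 t)] are simple. They are the parameters of the point at infinity
    ([sin t = 0]) and of the point with [y = 0] ([cos t = 0]), where the lift cannot be
    differentiated through the first coordinate. *)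
Lemma sin_double_isolated (t0 : R) :
  exists2 d : R, 0 < d & forall t, 0 < `|t0 - t| < d -> sin (2 * t) != 0.
Proof.
have dsin := is_derive_sin2 t0.
have [s0|s0] := eqVneq (sin (2 * t0)) 0; last first.
  have sc := is_derive_continuous dsin.
  have : \forall t \near t0, sin (2 * t) != 0 by exact: (@cvgr_neq0 _ _ _ _ _ _ _ sc s0).
  move=> /nbhs_ballP[d /= d0 hd].
  by exists d => // t /andP[_ td]; exact: hd.
have c0 : cos (2 * t0) != 0.
  apply/eqP => c0; have /eqP := cos2Dsin2 (2 * t0).
  by rewrite s0 c0 !expr0n /= addr0 eq_sym oner_eq0.
case: dsin => hd he.
have hc : (fun k : R => k^-1 *: (sin (2 * (k *: 1 + t0)) - sin (2 * t0))) @ 0^'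
    --> 2 * cos (2 * t0) by rewrite -he; exact: hd.
have n0 : 2 * cos (2 * t0) != 0 by rewrite mulf_neq0 // pnatr_eq0.
have : \forall k \near (0 : R)^',
    k^-1 *: (sin (2 * (k *: 1 + t0)) - sin (2 * t0)) != 0.
  exact: (@cvgr_neq0 _ _ _ _ _ _ _ hc n0).
rewrite /dnbhs /within /= => /nbhs_ballP[d /= d0 hd'].
exists d => // t /andP[t0t td].
have := hd' (t - t0); rewrite /ball /= sub0r normrN distrC => /(_ td).
have tt : t - t0 != 0 by rewrite -normr_gt0 distrC.
move=> /(_ tt); rewrite s0 subr0 /GRing.scale /= mulr1 subrK.
by apply: contraNneq => ->; rewrite mulr0.
Qed.

(** The derivative may be missing at [t0] itself; continuity there suffices for the mean value
    argument on each side. *)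
Lemma const_near_of_derive0 (f : R -> R) (t0 d : R) :
  (forall t, `|t0 - t| < d -> {for t, continuous f}) ->
  (forall t, 0 < `|t0 - t| < d -> is_derive t (1 : R) f 0) ->
  forall t, `|t0 - t| < d -> f t = f t0.
Proof.
move=> cf df t td; have [tt|tt] := leP t0 t.
  apply/esym/eq_of_derive0 => // s /andP[s1 s2].
    by apply: cf; move: td; rewrite !ltr_norml; lra.
  by apply: df; rewrite distrC gtr0_norm ?subr_gt0 //; move: td; rewrite !ltr_norml; lra.
apply: eq_of_derive0; first exact: ltW.
  by move=> s /andP[s1 s2]; apply: cf; move: td; rewrite !ltr_norml; lra.
move=> s /andP[s1 s2].
by apply: df; rewrite gtr0_norm ?subr_gt0 //; move: td; rewrite !ltr_norml; lra.
Qed.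

Variable J : R -> R.
Hypothesis dJ : forall t : R, -1 < t -> is_derive t (1 : R) J (r * delta t)^-1.

(** For a local lift [g], both [Re g - J] and [Im g] have zero derivative on a punctured
    neighbourhood, so [g - J] is the constant [k]. *)
Lemma local_lift_primitive (t0 : R) : -1 < t0 ->
  exists (k : C) (d : R), 0 < d /\
  forall t, `|t0 - t| < d -> proj_eq (weierstrass_map L (k + toCx (J t))) (loop t).
Proof.
move=> t0N; have [g [d1 d10 hg]] := local_lift t0.
have [d2 d20 hd2] := sin_double_isolated t0.
(* The bound [t0 + 1] keeps [t] above -1, where [J] has a known derivative. *)
pose d := Num.min d1 (Num.min d2 (t0 + 1)).
have d0 : 0 < d by rewrite !lt_min d10 d20 /=; lra.
have dd t : `|t0 - t| < d -> [/\ `|t0 - t| < d1, `|t0 - t| < d2 & -1 < t].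
  rewrite !lt_min => /and3P[-> ->]; rewrite ltr_norml => h1; split=> //; lra.
have dg t : 0 < `|t0 - t| < d ->
    is_derive t (1 : R) (fun s => complex.Re (g s)) (r * delta t)^-1 /\
    is_derive t (1 : R) (fun s => complex.Im (g s)) 0.
  move=> /andP[tt td]; have [td1 td2 tN] := dd t td.
  have : sin (2 * t) != 0 by apply: hd2; rewrite tt.
  rewrite sin_double !mulf_eq0 !negb_or => /and3P[_ s0 c0].
  have aff s : sin s != 0 -> `|t0 - s| < d1 ->
      [/\ g s \notin L, weierstrass_p L (g s) = toCx (loop_x s / loop_z s)
        & derive1 (weierstrass_p L) (g s) = toCx (loop_y s / loop_z s)].
    move=> ss sd; have [_ pg] := hg s sd.
    have zs : toCx (loop_z s) != 0 by rewrite toCx_eq0 expf_neq0.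
    have [gL -> ->] := weierstrass_map_affine zs pg.
    by rewrite (toCxM (loop_x s)) (toCxM (loop_y s)) (toCxV (loop_z s)).
  have [gL ge gd] := aff t s0 td1.
  have y0 : loop_y t / loop_z t != 0.
    rewrite mulf_neq0 ?invr_neq0 ?expf_neq0 // oppr_eq0.
    by rewrite !mulf_neq0 ?expf_neq0 ?pnatr_eq0 ?(lt0r_neq0 r_gt0) ?(lt0r_neq0 (delta_gt0 _)).
  have near_x : \forall s \near t, weierstrass_p L (g s) = toCx (loop_x s / loop_z s).
    have sn : \forall s \near t, sin s != 0.
      by exact: (@cvgr_neq0 _ _ _ _ _ _ _ (@continuous_sin R t) s0).
    have dn : \forall s \near t, `|t0 - s| < d1.
      apply/nbhs_ballP; exists (d1 - `|t0 - t|); first by rewrite /= subr_gt0.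
      move=> s; rewrite /ball /= => ts.
      by have := ler_distD t t0 s; lra.
    near=> s.
    have ss : sin s != 0 by near: s.
    have sd : `|t0 - s| < d1 by near: s.
    by have [] := aff s ss sd.
  have [gc _] := hg t td1.
  have [h1 h2] := lifted_path_derive (weierstrass_p_derivable bihol gL)
    gd y0 gc (loop_coord_derive s0 c0) near_x.
  split=> //; apply: is_derive_eq h1 _.
  by rewrite mulrAC divff ?mul1r.
have dgt t : `|t0 - t| < d -> {for t, continuous g}.
  by move=> /dd[/hg[]].
have re t : `|t0 - t| < d -> complex.Re (g t) - J t = complex.Re (g t0) - J t0.
  move=> td; apply: (@const_near_of_derive0 (fun s => complex.Re (g s) - J s) t0 d) => // s sd.
    have [_ _ sN] := dd s sd.
    apply: cvgB; last exact: is_derive_continuous (dJ sN).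
    by apply: (cvg_comp g (@complex.Re R : C -> R)); [exact: dgt | exact: Re_continuous].
  have [_ _ sN] : [/\ `|t0 - s| < d1, `|t0 - s| < d2 & -1 < s].
    by apply: dd; case/andP: sd.
  have h1 := dJ sN; have [h2 _] := dg s sd.
  by rewrite -(subrr (r * delta s)^-1); exact: is_deriveB.
have im t : `|t0 - t| < d -> complex.Im (g t) = complex.Im (g t0).
  move=> td; apply: (@const_near_of_derive0 (fun s => complex.Im (g s)) t0 d) => // s sd.
    by apply: (cvg_comp g (@complex.Im R : C -> R)); [exact: dgt | exact: Im_continuous].
  by have [] := dg s sd.
exists (g t0 - toCx (J t0)), d; split=> // t td.
have -> : g t0 - toCx (J t0) + toCx (J t) = g t.
  have := re t td; have := im t td.
  case: (g t) => a b; case: (g t0) => a0 b0 /= -> e.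
  apply/eqP; rewrite eq_complex /= oppr0 !addr0 eqxx andbT -e.
  by rewrite subrK.
by have [td1 _ _] := dd t td; have [] := hg t td1.
Unshelve. all: by end_near. Qed.

Hypothesis J0 : J 0 = 0.
Hypothesis L0 : 0 \in L.

(* The set of [t] such that [toCx (J t)] lifts [loop t] is locally constant: its
   indicator has zero derivative. *)
Lemma loop_lift (t : R) : 0 <= t -> proj_eq (weierstrass_map L (toCx (J t))) (loop t).
Proof.
move=> t0.
pose A (s : R) := proj_eq (weierstrass_map L (toCx (J s))) (loop s).
pose f (s : R) : R := if `[< A s >] then 1 else 0.
case: (bihol) => _ _ inj _ _.
have loc (s : R) : 0 <= s -> \forall u \near s, f s = f u.
  move=> s0; have s1 : -1 < s by lra.
  have [k [d [d0 hd]]] := local_lift_primitive s1.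
  (* Both [J u] and [k + J u] lift [loop u] exactly when they differ by a lattice point, a condition
     on [k] alone. *)
  have AE u : `|s - u| < d -> A u <-> L (- k).
    move=> /hd pu.
    have -> : - k = toCx (J u) - (k + toCx (J u)) by rewrite opprD addrCA subrr addr0.
    rewrite -inj; split=> [au|au].
      by apply: proj_eq_trans au (proj_eq_sym pu).
    exact: proj_eq_trans au pu.
  apply/nbhs_ballP; exists d => // u su.
  rewrite /f; congr (if _ then _ else _); apply: asbool_equiv_eq.
  by rewrite (AE u) // (AE s) // subrr normr0.
have df (s : R) : 0 <= s -> is_derive s (1 : R) f 0.
  move=> s0; exact: (@near_eq_is_derive _ _ _ (fun=> f s) f s 1 0 (loc s s0)).
have f0 : f 0 = 1.
  rewrite /f; case: asboolP => // -[].
  rewrite /A J0 toCx0 weierstrass_map_in //.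
  have y0 : toCx (loop_y 0) != 0.
    by rewrite toCx_eq0; apply: loop_neq0; rewrite /loop_z sin0 expr0n.
  exists (toCx (loop_y 0))^-1; first by rewrite invr_neq0.
  apply/rowP => j; rewrite !mxE; case: j => -[|[|[|//]]] jl /=.
  - by rewrite /loop_x sin0 mul0r toCx0 mulr0.
  - by rewrite mulVf.
  - by rewrite /loop_z sin0 expr0n /= toCx0 mulr0.
have : f 0 = f t.
  apply: eq_of_derive0 => // s /andP[s0 _]; first exact: is_derive_continuous (df s s0).
  by apply: df; exact: ltW.
by rewrite f0 /f; case: asboolP => // _ /eqP; rewrite oner_eq0.
Qed.

(** At [t = pi] the loop is back at infinity, the image of 0, so injectivity modulo [L] applies. *)
Lemma primitive_pi_in : L (toCx (J pi)).
Proof.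
case: (bihol) => _ _ inj _ _.
rewrite -[toCx (J pi)]subr0 -inj (@weierstrass_map_in _ L 0) //.
apply: proj_eq_trans (loop_lift (pi_ge0 R)) _.
have z0 : loop_z pi = 0 by rewrite /loop_z sinpi expr0n.
exists (toCx (loop_y pi)); first by rewrite toCx_eq0; exact: loop_neq0.
apply/rowP => j; rewrite !mxE; case: j => -[|[|[|//]]] jl /=.
- by rewrite /loop_x sinpi mul0r toCx0 mulr0.
- by rewrite mulr1.
- by rewrite z0 toCx0 mulr0.
Qed.

(** Between 0 and [pi] the loop stays in the affine part, while lattice points are sent to
    infinity. *)
Lemma primitive_notin (t : R) : 0 < t < pi -> ~ L (toCx (J t)).
Proof.
move=> tpi Lt; have /andP[t0 _] := tpi.
have zt : toCx (loop_z t) != 0.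
  by rewrite toCx_eq0 expf_neq0 // lt0r_neq0 // sin_gt0_pi.
have [/negP[]] := weierstrass_map_affine zt (loop_lift (ltW t0)).
exact: mem_set.
Qed.

End RealLoop.

(** * The real period as a value of the Gauss series *)

Section RealPeriod.
Variable R : realType.
Set Implicit Arguments.
Unset Strict Implicit.
Local Notation C := (Cx R).

(** If [w'] enters with a nonzero coefficient [n], it is real and so is all of [L], against the
    independence of [w1] and [w2] over the reals. *)
Lemma lattice_real_multiple (L : set C) (w : R) (w' : C) (x : R) :
  is_lattice L -> L = Zspan (toCx w) w' -> L (toCx x) -> exists m : int, x = m%:~R * w.
Proof.
move=> [w1 [w2 [indep LE]]] LZ; rewrite LZ => -[m [n e]].
have [n0|n0] := eqVneq n 0.
  exists m; apply: (@toCxI R).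
  by rewrite e n0 mul0r addr0 toCxM toCx_int.
have n0' : (n%:~R : C) != 0 by rewrite intr_eq0.
have w'E : w' = toCx ((x - m%:~R * w) / n%:~R).
  rewrite toCxM toCxV toCxB toCxM !toCx_int e addrAC subrr add0r.
  by rewrite mulrAC divff ?mul1r.
have reL z : L z -> exists y, z = toCx y.
  rewrite LZ => -[a [b ->]]; rewrite w'E.
  exists (a%:~R * w + b%:~R * ((x - m%:~R * w) / n%:~R)).
  by rewrite toCxD (toCxM a%:~R) (toCxM b%:~R) !toCx_int.
have [y1 e1] : exists y, w1 = toCx y.
  by apply: reL; rewrite LE; exists 1, 0; rewrite !mul1r mul0r addr0.
have [y2 e2] : exists y, w2 = toCx y.
  by apply: reL; rewrite LE; exists 0, 1; rewrite !mul1r mul0r add0r.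
have rel : toCx y2 * w1 + toCx (- y1) * w2 = 0.
  by rewrite e1 e2 toCxN mulNr [toCx y1 * _]mulrC subrr.
(* This relation forces [w1 = w2 = 0], and then the relation with both coefficients 1 is a
   contradiction. *)
have [y20 /eqP] := indep _ _ rel; rewrite oppr_eq0 => /eqP y10.
have rel1 : toCx 1 * w1 + toCx 1 * w2 = 0.
  by rewrite e1 e2 y10 y20 !toCx0 !mulr0 addr0.
by have [/eqP] := indep _ _ rel1; rewrite oner_eq0.
Qed.

(** [J pi] is a positive multiple [m] of [Omega]. If [m > 1], the intermediate value theorem gives
    [Omega = J t] with [0 < t < pi], which [primitive_notin] forbids. *)
Lemma real_period_primitive (L : set C) (g2 g3 h lam r Omega : R) (J : R -> R) :
  is_period_lattice g2 g3 L -> 0 < Omega ->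
  (exists w : C, L = Zspan (toCx Omega) w) ->
  (forall x : R, 4 * ((x + h - 1) * ((x + h) ^+ 2 + lam)) = 4 * x ^+ 3 - g2 * x - g3) ->
  1 < r -> r ^+ 4 = 1 + lam ->
  (forall t : R, -1 < t -> is_derive t (1 : R) J (r * delta r t)^-1) -> J 0 = 0 ->
  Omega = J pi.
Proof.
move=> [Llat bihol] Omega0 [w LZ] cubicE r1 r4 dJ J0.
have L0 : 0 \in L.
  by apply: mem_set; rewrite LZ; exists 0, 0; rewrite !mul0r addr0.
have LOmega : L (toCx Omega).
  by rewrite LZ; exists 1, 0; rewrite mul1r mul0r addr0.
have [m Jpi] := lattice_real_multiple Llat LZ
  (primitive_pi_in bihol cubicE r1 r4 dJ J0 L0).
have notin := primitive_notin bihol cubicE r1 r4 dJ J0 L0.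
have t1 (t : R) : 0 <= t -> -1 < t by lra.
have cJ (t : R) : 0 <= t <= pi -> {for t, continuous J}.
  by move=> /andP[t0 _]; exact: is_derive_continuous (dJ t (t1 t t0)).
have dJ' (t : R) : 0 < t < pi -> is_derive t (1 : R) J (r * delta r t)^-1.
  by move=> /andP[t0 _]; apply: dJ; rewrite t1 // ltW.
have Jpi0 : 0 < J pi.
  have [c _] := mean_value (pi_gt0 R) cJ dJ'; rewrite J0 !subr0 => ->.
  rewrite mulr_gt0 ?pi_gt0 // invr_gt0 mulr_gt0 ?delta_gt0 //.
  exact: lt_trans r1.
have m0 : 0 < m by move: Jpi0; rewrite Jpi pmulr_lgt0 // ltr0z.
have [mE|m1] := eqVneq m 1; first by rewrite Jpi mE mul1r.
have m2 : 1 < m by rewrite lt_neqAle eq_sym m1.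
have OJ : Omega < J pi by rewrite Jpi ltr_pMl // ltr1z.
have [|||t tpi JE] := @IVT R J 0 pi Omega.
- exact: pi_ge0.
- apply: continuous_in_subspaceT => t /set_mem /= tpi.
  by apply: cJ; rewrite !(itvP tpi).
- by rewrite J0 ge_min (ltW Omega0) le_max (ltW OJ) orbT.
case: (notin t); last by rewrite JE.
have t0 : 0 <= t by rewrite (itvP tpi).
have tp : t <= pi by rewrite (itvP tpi).
rewrite !lt_neqAle t0 tp !andbT; apply/andP; split.
  by apply/eqP => e; move: Omega0; rewrite -JE -e J0 ltxx.
by apply/eqP => e; move: OJ; rewrite -JE e ltxx.
Qed.

Lemma fourth_root_gt1 (lam : R) : 0 < lam -> 1 < Num.sqrt (Num.sqrt (1 + lam)).
Proof.
move=> lam0; have s1 : 1 < Num.sqrt (1 + lam).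
  by rewrite -(ltr_pXn2r (n := 2)) ?nnegrE ?sqrtr_ge0 // sqr_sqrtr ?expr1n; lra.
by rewrite -(ltr_pXn2r (n := 2)) ?nnegrE ?sqrtr_ge0 // sqr_sqrtr ?expr1n // ltW // (lt_trans ltr01).
Qed.

Lemma real_period_gauss (lam Omega : R) (lam0 : lam != 0) (lam1 : lam != -1) :
  0 < lam -> is_real_period (E_lambda lam0 lam1) Omega ->
  Num.sqrt (1 + lam) * Omega ^+ 2 / pi ^+ 2 =
  gauss 2^-1 (elliptic_parameter (Num.sqrt (Num.sqrt (1 + lam)))) ^+ 2.
Proof.
move=> lam_gt0 [h [g2 [g3 [cub [L [Lper Omega0 LZ]]]]]].
have s0 : 0 <= Num.sqrt (1 + lam) by exact: sqrtr_ge0.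
set r := Num.sqrt (Num.sqrt (1 + lam)).
have r2 : r ^+ 2 = Num.sqrt (1 + lam) by rewrite sqr_sqrtr.
have r4 : r ^+ 4 = 1 + lam.
  by rewrite (exprM r 2 2) r2 sqr_sqrtr //; lra.
have r1 : 1 < r by exact: fourth_root_gt1.
have r0 : 0 < r by exact: lt_trans r1.
have cubicE (x : R) :
    4 * ((x + h - 1) * ((x + h) ^+ 2 + lam)) = 4 * x ^+ 3 - g2 * x - g3.
  have := congr1 (fun p => p.[x]) cub.
  by rewrite /= /cubic_lambda !(hornerE, horner_comp).
have dc : continuous (fun t : R => (r * delta r t)^-1).
  move=> t; apply: cvgV.
    by rewrite mulf_neq0 // ?(lt0r_neq0 r0) // lt0r_neq0 // delta_gt0.
  apply: cvgMr; apply: (cvg_comp _ (@Num.sqrt R)); last exact: sqrt_continuous.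
  apply: cvgB; first exact: cvg_cst.
  apply: cvgMr; apply: (cvg_comp (fun s : R => sin (2 * s)) (fun x : R => x ^+ 2)).
    exact: is_derive_continuous (is_derive_sin2 t).
  exact: exprn_continuous.
have [J dJ] := exists_primitive (-1) dc.
pose K t := J t - J 0.
have dK (t : R) : -1 < t -> is_derive t (1 : R) K (r * delta r t)^-1.
  move=> t1; have h1 := dJ t t1.
  by rewrite -[X in is_derive _ _ _ X]subr0; exact: is_deriveB.
have K0 : K 0 = 0 by rewrite /K subrr.
have OK : Omega = K pi := real_period_primitive Lper Omega0 LZ cubicE r1 r4 dK K0.
have /andP[q0 q1] := elliptic_parameter_bounds r1.
have G : r * K pi - r * K 0 = pi * gauss 2^-1 (elliptic_parameter r).
  apply: (@gauss_primitive R (elliptic_parameter r) (fun t => r * K t)).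
    by rewrite q0; lra.
  move=> t /andP[t0 _]; have h1 : is_derive t (1 : R) K (r * delta r t)^-1.
    by apply: dK; lra.
  have h2 := is_derive_mul (is_derive_const r t) h1.
  apply: is_derive_eq h2 _; rewrite mul0r add0r /delta invfM mulrA divff ?mul1r //.
  exact: lt0r_neq0.
have pi0 : (pi : R) != 0 by rewrite lt0r_neq0 // pi_gt0.
(* As [sqrt (1 + lam) = r ^ 2], the left side is [(r Omega / pi) ^ 2]. *)
rewrite -r2 OK; rewrite K0 mulr0 subr0 in G.
by rewrite -exprMn G exprMn mulrAC divff ?mul1r // expf_neq0.
Qed.

(** [1 - 2 q = r ^ -2], hence [4 q (1 - q) = 1 - r ^ -4]. *)
Lemma elliptic_parameter_quadratic (lam : R) : 0 < lam ->
  let q := elliptic_parameter (Num.sqrt (Num.sqrt (1 + lam))) in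
  4 * q * (1 - q) = lam / (1 + lam).
Proof.
move=> lam0; rewrite /elliptic_parameter sqr_sqrtr ?sqrtr_ge0 //=.
have l1 : 0 <= 1 + lam by lra.
have e := sqr_sqrtr l1.
have s0 : Num.sqrt (1 + lam) != 0 by rewrite lt0r_neq0 // sqrtr_gt0; lra.
transitivity (1 - (Num.sqrt (1 + lam) ^+ 2)^-1); first by field.
by rewrite e; field; lra.
Qed.

Lemma pFq_clausen (x : R) : 0 <= x < 1 ->
  pFq [:: 2^-1; 2^-1; 2^-1] [:: 1; 1] (toCx x) = toCx (gauss 4^-1 x ^+ 2).
Proof.
move=> x01; have cl := clausen x01.
have e2 : (2^-1 : C) = toCx 2^-1 by rewrite toCxV toCx_nat.
have poch (a : R) n : pochhammer (toCx a) n = toCx (\prod_(i < n) (a + i%:R)).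
  rewrite /toCx (rmorph_prod (real_complex R)); apply: eq_bigr => i _.
  by rewrite -[RHS]/(toCx (a + i%:R)) toCxD toCx_nat.
have fact (n : nat) : \prod_(i < n) (1 + i%:R) = n`!%:R :> R.
  elim: n => [|n IHn]; first by rewrite big_ord0.
  by rewrite big_ord_recr /= IHn factS natrM mulrC nat1r.
have rr n : rising_ratio (2^-1 : R) n = (\prod_(i < n) (2^-1 + i%:R)) / n`!%:R.
  rewrite /rising_ratio prodf_div -fact; congr (_ / _).
  by apply: eq_bigr => i _; rewrite nat1r.
(* The two factors [(1)_n = n!] and the factorial of the exponential series supply the three
   denominators of [rising_ratio 2^-1 n ^+ 3]. *)
have termE n : pFq_term [:: 2^-1; 2^-1; 2^-1] [:: 1; 1] (toCx x) n =
    toCx (rising_ratio 2^-1 n ^+ 3 * x ^+ n).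
  have poch1 : pochhammer (1 : C) n = toCx (n`!%:R) by rewrite -fact -poch toCx1.
  rewrite /pFq_term !big_cons !big_nil poch1 e2 poch rr toCx_nat.
  have nf : (n`!%:R : C) != 0 by rewrite pnatr_eq0 -lt0n fact_gt0.
  by rewrite toCxM !toCxX toCxM toCxV toCx_nat; field.
have serE : series (pFq_term [:: 2^-1; 2^-1; 2^-1] [:: 1; 1] (toCx x)) =
    fun n => toCx (pseries (fun n => rising_ratio 2^-1 n ^+ 3) x n).
  apply/funext => n; rewrite /pseries /series /= /toCx (rmorph_sum (real_complex R)).
  by apply: eq_bigr => i _; exact: termE.
rewrite /pFq serE; apply: cvg_lim => //.
by apply: (cvg_comp _ (toCx : R -> C) cl); exact: toCx_continuous.
Qed.

End RealPeriod.

Theorem theorem2p1 (R : realType) (lambda : R)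
    (lambda0 : lambda != 0) (lambda1 : lambda != -1)
    (lambda_gt0 : 0 < lambda)
    (Omega : R) (HOmega : is_real_period (E_lambda lambda0 lambda1) Omega) :
  pFq [:: 2^-1; 2^-1; 2^-1] [:: 1; 1] (toCx (lambda / (1 + lambda))) =
  toCx (Num.sqrt (1 + lambda) * Omega ^+ 2 / pi ^+ 2).
Proof.
(* The bound [q < 1/2], from [r > 1], places [q] on the branch where the quadratic transformation
   holds. *)
have /andP[q0 q1] := elliptic_parameter_bounds (fourth_root_gt1 lambda_gt0).
rewrite (real_period_gauss lambda_gt0 HOmega) gauss_quadratic ?q0 //.
rewrite elliptic_parameter_quadratic // pFq_clausen //.
have l1 : 0 < 1 + lambda by lra.
by rewrite divr_ge0 ?(ltW lambda_gt0) ?(ltW l1) //= ltr_pdivrMr // mul1r; lra.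
Qed.
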